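(* Let $M$ be a connected matroid of size $n\geq 2$ and rank $r$, and let $\ell=n-r$. Then $$H_{r-1}+H_{\ell-1}+\frac{1}{(n-1)\binom{n-2}{r-1}}\leq \mathrm{ehr}_M'(0).$$ Moreover, equality holds if and only if $M\cong\mathsf{T}_{r,n}$.
   Context: Matroids are on finite ground sets; the size of a matroid is the number of elements of its ground set, identified with $\{1,\dots,n\}$. For a subset $A$ of the ground set let $\mathsf{e}_A=\sum_{i\in A}\mathsf{e}_i\in\{0,1\}^n$. The matroid polytope is $\mathscr{P}_M=\mathrm{conv}\{\mathsf{e}_B : B\text{ is a basis of }M\}\subset\mathbb{R}^n$. The Ehrhart polynomial $\mathrm{ehr}_M\in\mathbb{Q}[t]$ is the unique polynomial with $\mathrm{ehr}_M(k)=|\mathbb{Z}^n\cap k\mathscr{P}_M|$ for every integer $k\geq 0$; $\mathrm{ehr}_M'(0)$ is its linear coefficient. $H_k=1+\frac12+\dots+\frac1k$ are the harmonic numbers, with $H_0=0$. $\mathsf{U}_{r,n}$ is the uniform matroid of rank $r$ on $n$ elements. For $1\leq r<n$ and $\ell=n-r$, the minimal matroid is the 2-sum $\mathsf{T}_{r,n}=\mathsf{U}_{r,r+1}\oplus_2\mathsf{U}_{1,\ell+1}$; equivalently, it is the graphic matroid of the graph obtained from the cycle graph on $r+1$ vertices (with $r+1$ edges) by replacing one edge with $\ell$ parallel edges. (A connected matroid of size $n\geq2$ has $1\leq r\leq n-1$.) *)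

(* Defs.v *)
From HB Require Import structures.
From mathcomp Require Import all_boot all_order all_algebra.
From mathcomp Require Import classical_sets cardinality reals.

Set Implicit Arguments.
Unset Strict Implicit.
Unset Printing Implicit Defensive.

Import GRing.Theory Num.Theory.

Local Open Scope ring_scope.

Record matroid (T : finType) := Matroid {
  bases : {set {set T}};
  bases_neq0 : bases != finset.set0;
  bases_exchange : forall A B : {set T}, A \in bases -> B \in bases ->
    forall x, x \in A -> x \notin B ->
    exists y, [/\ y \in B, y \notin A & (y |: (A :\ x))%SET \in bases] }.

Section MatroidNotions.
Variables (T : finType) (M : matroid T).

Definition indep (A : {set T}) : bool := [exists B in bases M, A \subset B].

Definition circuit (C : {set T}) : bool := minset [pred A | ~~ indep A] C.

Definition loop (x : T) : bool := [forall B in bases M, x \notin B].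

Definition coloop (x : T) : bool := [forall B in bases M, x \in B].

Definition connected : Prop :=
  forall x y : T, x != y -> exists C, [/\ circuit C, x \in C & y \in C].

Definition rank : nat := \max_(B in bases M) #|B|.

End MatroidNotions.

Definition isomorphic (T1 T2 : finType) (M1 : matroid T1) (M2 : matroid T2) :
    Prop :=
  exists2 f : T1 -> T2, bijective f &
    forall B : {set T1}, (B \in bases M1) = ((f @: B)%SET \in bases M2).

Section Uniform.
Variables r n : nat.

(* For r <= n, the rank is r; [minn] only makes the definition total. *)
Definition uniform_bases : {set {set 'I_n}} :=
  [set B : {set 'I_n} | #|B| == minn r n]%SET.

Lemma uniform_bases_neq0 : uniform_bases != finset.set0.
Proof.
rewrite -card_gt0 card_draws card_ord bin_gt0; exact: geq_minr.
Qed.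

Lemma uniform_bases_exchange (A B : {set 'I_n}) :
  A \in uniform_bases -> B \in uniform_bases ->
  forall x, x \in A -> x \notin B ->
  exists y, [/\ y \in B, y \notin A & (y |: (A :\ x))%SET \in uniform_bases].
Proof.
rewrite !inE => /eqP cA /eqP cB x xA xB.
have /subsetPn[y yB yA] : ~~ (B \subset A).
  apply/negP => sBA; have /eqP eBA : B == A by rewrite eqEcard sBA cA cB leqnn.
  by rewrite eBA xA in xB.
exists y; split=> //.
by rewrite inE cardsU1 !inE (negbTE yA) andbF /= -cA (cardsD1 x A) xA.
Qed.

Definition uniform : matroid 'I_n :=
  Matroid uniform_bases_neq0 uniform_bases_exchange.

End Uniform.

Section TwoSum.
Variables (T1 T2 : finType) (M1 : matroid T1) (M2 : matroid T2).
Variables (p1 : T1) (p2 : T2).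

Local Notation T := ({x : T1 | x != p1} + {x : T2 | x != p2})%type.

Definition glue (B1 : {set T1}) (B2 : {set T2}) : {set T} :=
  [set u : T | match u with
               | inl x => val x \in B1
               | inr x => val x \in B2
               end]%SET.

(* Identifying the basepoints p1 and p2 to a single element p, the bases of the
   2-sum are the sets (B1 :|: B2) :\ p where B1 and B2 are bases and p belongs
   to exactly one of them. *)
Definition two_sum_bases : {set {set T}} :=
  [set B | [exists B1 in bases M1, exists B2 in bases M2,
              ((p1 \in B1) (+) (p2 \in B2)) && (B == glue B1 B2)]]%SET.

Lemma two_sum_basesP B :
  reflect (exists B1 B2, [/\ B1 \in bases M1, B2 \in bases M2,
             (p1 \in B1) (+) (p2 \in B2) & B = glue B1 B2])
          (B \in two_sum_bases).
Proof.
rewrite inE; apply: (iffP exists_inP).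
  move=> [B1 h1 /exists_inP[B2 h2 /andP[h /eqP e]]].
  by exists B1, B2.
move=> [B1 [B2 [h1 h2 h e]]]; exists B1 => //; apply/exists_inP; exists B2 => //.
by rewrite h e eqxx.
Qed.

Hypothesis ncp1 : ~~ coloop M1 p1.
Hypothesis nlp2 : ~~ loop M2 p2.

Lemma two_sum_bases_neq0 : two_sum_bases != finset.set0.
Proof.
have [B1 h1 p1B] := forall_inPn ncp1.
have [B2 h2] := forall_inPn nlp2; rewrite negbK => p2B.
apply/set0Pn; exists (glue B1 B2); apply/two_sum_basesP; exists B1, B2.
by rewrite (negbTE p1B) p2B.
Qed.

Lemma two_sum_bases_exchange (A B : {set T}) :
  A \in two_sum_bases -> B \in two_sum_bases ->
  forall x, x \in A -> x \notin B ->
  exists y, [/\ y \in B, y \notin A & (y |: (A :\ x))%SET \in two_sum_bases].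
Proof.
move=> /two_sum_basesP[A1 [A2 [hA1 hA2 hA ->]]].
move=> /two_sum_basesP[B1 [B2 [hB1 hB2 hB ->]]] [x|x]; rewrite !inE => xA xB.
- have [y [yB yA hy]] := bases_exchange hA1 hB1 xA xB.
  have px : p1 != val x by rewrite eq_sym (valP x).
  have [yp|yp] := eqVneq y p1.
    have p1A : p1 \notin A1 by rewrite -yp.
    have p2A : p2 \in A2 by move: hA; rewrite (negbTE p1A).
    have p2B : p2 \notin B2 by move: hB; rewrite -yp yB.
    have [z [zB zA hz]] := bases_exchange hA2 hB2 p2A p2B.
    have zp : z != p2 by apply: contraNneq zA => ->.
    exists (inr (Sub z zp)); split; [by rewrite inE | by rewrite inE | ].
    apply/two_sum_basesP.
    exists (y |: (A1 :\ val x))%SET, (z |: (A2 :\ p2))%SET; split => //.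
      by rewrite !inE yp eqxx /= eq_sym (negbTE zp) eqxx.
    apply/setP => -[u|u]; rewrite !inE /=.
      have -> : (inl u == inl x :> T) = (val u == val x) by [].
      by rewrite yp (negbTE (valP u)).
    have -> : (inr u == inr (Sub z zp) :> T) = (val u == z) by [].
    by rewrite (negbTE (valP u)).
  exists (inl (Sub y yp)); split; [by rewrite inE | by rewrite inE | ].
  apply/two_sum_basesP; exists (y |: (A1 :\ val x))%SET, A2; split => //.
    by rewrite !inE eq_sym (negbTE yp) px.
  by apply/setP => -[u|u]; rewrite !inE.
- have [y [yB yA hy]] := bases_exchange hA2 hB2 xA xB.
  have px : p2 != val x by rewrite eq_sym (valP x).
  have [yp|yp] := eqVneq y p2.
    have p2A : p2 \notin A2 by rewrite -yp.
    have p1A : p1 \in A1 by move: hA; rewrite (negbTE p2A) addbF.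
    have p1B : p1 \notin B1 by move: hB; rewrite -yp yB addbT.
    have [z [zB zA hz]] := bases_exchange hA1 hB1 p1A p1B.
    have zp : z != p1 by apply: contraNneq zA => ->.
    exists (inl (Sub z zp)); split; [by rewrite inE | by rewrite inE | ].
    apply/two_sum_basesP.
    exists (z |: (A1 :\ p1))%SET, (y |: (A2 :\ val x))%SET; split => //.
      by rewrite !inE yp eqxx /= eq_sym (negbTE zp) eqxx.
    apply/setP => -[u|u]; rewrite !inE /=.
      have -> : (inl u == inl (Sub z zp) :> T) = (val u == z) by [].
      by rewrite (negbTE (valP u)).
    have -> : (inr u == inr x :> T) = (val u == val x) by [].
    by rewrite yp (negbTE (valP u)).
  exists (inr (Sub y yp)); split; [by rewrite inE | by rewrite inE | ].
  apply/two_sum_basesP; exists A1, (y |: (A2 :\ val x))%SET; split => //.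
    by rewrite !inE [p2 == y]eq_sym (negbTE yp) px.
  by apply/setP => -[u|u]; rewrite !inE.
Qed.

(* The 2-sum is usually formed only when neither basepoint is a loop or a
   coloop; the weaker hypotheses ncp1 and nlp2 suffice for the basis axioms. *)
Definition two_sum : matroid T :=
  Matroid two_sum_bases_neq0 two_sum_bases_exchange.

End TwoSum.

Lemma uniform_not_coloop r : ~~ coloop (uniform r r.+1) ord0.
Proof.
apply/forall_inPn; exists (~: [set ord0])%SET; last by rewrite !inE eqxx.
by rewrite inE cardsC1 card_ord (minn_idPl (leqnSn r)).
Qed.

Lemma uniform_not_loop l : ~~ loop (uniform 1 l.+1) ord0.
Proof.
apply/forall_inPn; exists [set ord0]%SET; last by rewrite !inE eqxx.
by rewrite inE cards1 (minn_idPl (ltn0Sn l)).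
Qed.

(* Meant for 1 <= r < n, where no basepoint is a loop or a coloop. *)
Definition minimal_matroid (r n : nat) :=
  two_sum (uniform_not_coloop r) (uniform_not_loop (n - r)).

Section Polytope.
Variable R : realType.

Definition convex_hull (V : lmodType R) (S : set V) : set V :=
  [set x | exists m (w : 'I_m -> R) (v : 'I_m -> V),
     [/\ forall i, 0 <= w i, \sum_i w i = 1, forall i, S (v i)
       & x = \sum_i w i *: v i]]%classic.

Definition indicator_vec n (A : {set 'I_n}) : 'rV[R]_n :=
  \row_i (i \in A)%:R.

Definition matroid_polytope n (M : matroid 'I_n) : set 'rV[R]_n :=
  convex_hull [set indicator_vec B | B in [set` bases M]]%classic.

Definition lattice_points n (P : set 'rV[R]_n) (k : nat) : set 'rV[int]_n :=
  [set z | exists2 x, P x & map_mx intr z = k%:R *: x]%classic.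

Definition is_ehrhart_poly n (M : matroid 'I_n) (p : {poly rat}) : Prop :=
  forall k : nat, exists2 m : nat,
    (lattice_points (matroid_polytope M) k #= `I_m)%card & p.[k%:R] = m%:R.

Lemma is_ehrhart_poly_unique n (M : matroid 'I_n) (p q : {poly rat}) :
  is_ehrhart_poly M p -> is_ehrhart_poly M q -> p = q.
Proof.
move=> hp hq; apply/eqP; rewrite -subr_eq0; apply/negPn/negP => pq0.
pose s : seq rat := [seq k%:R | k <- iota 0 (size (p - q))].
have us : uniq s by rewrite map_inj_uniq ?iota_uniq //; exact: (mulrIn (oner_neq0 _)).
have rs : all (root (p - q)) s.
  apply/allP => _ /mapP[k _ ->]; rewrite rootE hornerD hornerN.
  have [m hm ->] := hp k; have [m' hm' ->] := hq k.
  suff -> : m = m' by rewrite subrr.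
  by apply/card_eq_II; apply: card_eq_trans hm'; rewrite card_eq_sym.
by have := max_poly_roots pq0 rs us; rewrite size_map size_iota ltnn.
Qed.

End Polytope.

Definition harmonic_number (k : nat) : rat := \sum_(1 <= i < k.+1) i%:R^-1.

(* Main.v *)
Require Import Defs.
From mathcomp Require Import classical_sets cardinality reals.
From mathcomp Require Import all_boot all_order all_algebra.
From mathcomp Require Import ring lra zify.

(** The linear coefficient of the Ehrhart polynomial of the base polytope of a
    polymatroid f on n elements is
      L(f) = \sum_(0 < A < E) f(A) beta(|A|-1, n-|A|-1) - f(E) H_(n-1),
    beta(a, b) = a! b! / (a+b+1)!.  Indeed, counting lattice points by inclusion-
    exclusion over chains of violated inequalities x(A) <= f(A) shows that the
    number of lattice points is a polynomial in the values of f, so the linear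
    coefficient is linear in f; it is determined by the simplices
    f(A) = [A meets I], whose Ehrhart polynomial is 'C(t + |I| - 1, |I| - 1).

    The lower bound is proved by induction on n.  By Tutte, deleting or
    contracting a given e keeps M connected, and L is invariant under duality, so
    e may be assumed to be deleted.  Then L(M) - L(M \ e) is the sum of
    beta(|A|, n-|A|-2) over the sets A not spanning e.  If B + e is a basis, these
    include all subsets of B and, M having no coloop, for each proper subset X of B
    a set X + g with g outside B; this accounts for the bound.  In the equality
    case, exactly r elements are not parallel to e, which characterizes T_(r,n). *)

Set Implicit Arguments.
Unset Strict Implicit.
Unset Printing Implicit Defensive.

Import Order.TTheory GRing.Theory Num.Theory.

Local Open Scope ring_scope.

(** Why chains: for crossing sets the violated inequalities need not have a polynomial count,
    whereas along S_1 < ... < S_m the conditions f(S_i) < x(S_i) become nested ranges of summation,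
    which preserve polynomiality. Submodularity of f is what makes the alternating sum over chains
    the indicator of the base polytope; monotonicity keeps every range inside the region where the
    sum agrees with its polynomial.

    Rank functions and coefficients are taken relative to a subset U of one fixed type. Contraction
    is deletion in the dual rank function, so the induction never changes the ground type.

    The bound is tight because the two families of sets attached to B are disjoint and, by the
    Pascal rule for beta, their weights add up exactly to the increment of the minimal value when n
    grows by one with r fixed. Equality leaves no other set that fails to span e. For r > 1 the
    singletons in the two families are those of B and one {g}, which gives the r elements not
    parallel to e.

    The link to real polytopes is integer decomposition: an integral point of the k-th dilate is a
    sum of k bases. *)

(** Euler's integral of x^a (1-x)^b over [0,1]. Thus [beta_pascal] is x + (1-x) = 1 under the
    integral sign. *)
Definition beta (a b : nat) : rat := (a`! * b`!)%:R / ((a + b).+1)`!%:R.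

Lemma beta_gt0 a b : 0 < beta a b.
Proof. by rewrite divr_gt0 // ltr0n ?muln_gt0 ?fact_gt0. Qed.

Lemma betaC a b : beta a b = beta b a.
Proof. by rewrite /beta mulnC addnC. Qed.

Lemma beta0 b : beta 0 b = b.+1%:R^-1.
Proof.
have hb : b`!%:R != 0 :> rat by rewrite pnatr_eq0 -lt0n fact_gt0.
have hb1 : b.+1%:R != 0 :> rat by rewrite pnatr_eq0.
by rewrite /beta fact0 mul1n add0n factS natrM invfM mulrCA mulfV // mulr1.
Qed.

Lemma beta_pascal a b : beta a.+1 b + beta a b.+1 = beta a b.
Proof.
rewrite /beta addSn addnS (factS (a + b).+1) !factS.
set F := ((a + b)`!); have hF : F%:R != 0 :> rat by rewrite pnatr_eq0 -lt0n fact_gt0.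
have h1 : a.+1%:R + b%:R != 0 :> rat by rewrite -natrD pnatr_eq0.
have h2 : a.+2%:R + b%:R != 0 :> rat by rewrite -natrD pnatr_eq0.
rewrite !natrM -!addSn !natrD.
have e1 : a.+1%:R = a%:R + 1 :> rat by rewrite -natr1.
have e2 : a.+2%:R = a%:R + 2 :> rat by rewrite -addn2 natrD.
have e3 : b.+1%:R = b%:R + 1 :> rat by rewrite -natr1.
rewrite e1 e2 e3 in h1 h2 *.
by field; rewrite hF h1 h2.
Qed.

Lemma beta_bin a b : beta a b = ((a + b).+1 * 'C(a + b, a))%:R^-1.
Proof.
have := bin_fact (leq_addr b a); rewrite addKn /beta factS => <-.
have hF : (a`! * b`!)%:R != 0 :> rat.
  by rewrite pnatr_eq0 -lt0n muln_gt0 !fact_gt0.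
by rewrite mulnA [X in _ / X]natrM invfM mulrCA divff // mulr1.
Qed.

Lemma harmonicS k :
  harmonic_number k.+1 = harmonic_number k + k.+1%:R^-1.
Proof. by rewrite /harmonic_number big_nat_recr. Qed.

Lemma harmonic0 : harmonic_number 0 = 0.
Proof. by rewrite /harmonic_number big_geq. Qed.

(** * The linear coefficient as a functional *)

Section SubsetSums.
Variable T : finType.
Implicit Types (U A B : {set T}) (e : T).

Lemma sum_subsetD1 (V : nmodType) (F : {set T} -> V) U e : e \in U ->
  \sum_(A : {set T} | A \subset U) F A =
  \sum_(A : {set T} | A \subset U :\ e) (F A + F (e |: A)).
Proof.
move=> eU; rewrite big_split /= (bigID (fun A : {set T} => e \in A)) /= addrC.
congr (_ + _).
  by apply: eq_bigl => A; rewrite subsetD1.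
rewrite (reindex_onto (fun A => e |: A) (fun A => A :\ e)) /=; last first.
  by move=> A /andP[_ eA]; rewrite setD1K.
apply: eq_bigl => A; rewrite subUset sub1set eU setU11 /= subsetD1 andbT.
congr (_ && _); apply/eqP/idP => [<-|eA]; first by rewrite !inE eqxx.
by rewrite setU1K.
Qed.

(** Under the integral this is the binomial theorem, which leaves the integral of (1-x)^b. *)
Lemma sum_beta_subset (U : {set T}) b :
  \sum_(A : {set T} | A \subset U) beta #|A| (b + (#|U| - #|A|)) =
  b.+1%:R^-1.
Proof.
have [m] := ubnP #|U|; elim: m U b => // m IH U b.
have [->|[e eU]] := set_0Vmem U => leU.
  by rewrite (big_pred1 set0) ?cards0 ?beta0 ?addn0 // => A; rewrite /= subset0.
have cU := cardsD1 e U; rewrite eU add1n in cU.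
rewrite (sum_subsetD1 _ eU) -(IH (U :\ e)); last by rewrite -ltnS -cU.
apply: eq_bigr => A; rewrite subsetD1 => /andP[sA eA].
have : (#|A| <= #|U :\ e|)%N by rewrite subset_leq_card // subsetD1 sA.
rewrite cardsU1 eA add1n cU subSS => hA.
by rewrite -[RHS]beta_pascal addrC -addnS -subSn.
Qed.

Lemma sum_beta_proper (U : {set T}) b :
  \sum_(A : {set T} | A \proper U) beta #|A| (b + (#|U| - #|A|)) =
  b.+1%:R^-1 - beta #|U| b.
Proof.
rewrite -(sum_beta_subset U) [in RHS](bigD1 U) //= subnn addn0.
rewrite [X in _ = X - _]addrC addrK.
by apply: eq_bigl => A; rewrite properEneq andbC.
Qed.

Definition lincoef (U : {set T}) (g : {set T} -> rat) : rat :=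
  \sum_(A : {set T} | (A \proper U) && (A != set0))
     g A * beta #|A|.-1 (#|U| - #|A|).-1
  - g U * harmonic_number #|U|.-1.

(** By [beta_pascal] the weight of A in U is its weight in U - e minus the weight of A + e in U, so
    pairing A with A + e leaves the difference g(A + e) - g(A). The unpaired set U - e contributes
    g(U) / |U - e|, which is the step between the two harmonic numbers. *)
Lemma lincoef_delete U e (g : {set T} -> rat) :
  e \in U -> U :\ e != set0 -> g set0 = 0 -> g (U :\ e) = g U ->
  lincoef U g = lincoef (U :\ e) g +
    \sum_(A : {set T} | A \proper U :\ e)
       (g (e |: A) - g A) * beta #|A| (#|U :\ e| - #|A|).-1.
Proof.
move=> eU U'0 g0 gU; set U' := U :\ e.
have cU : #|U| = #|U'|.+1 by rewrite (cardsD1 e U) eU.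
have m0 : (0 < #|U'|)%N by rewrite card_gt0.
pose h A := if A != set0 then g A * beta #|A|.-1 (#|U| - #|A|).-1 else 0.
pose k A := if A != U' then
  g (e |: A) * beta #|A| (#|U'| - #|A|).-1 else 0.
have E1 : \sum_(A : {set T} | (A \proper U) && (A != set0))
     g A * beta #|A|.-1 (#|U| - #|A|).-1 =
   \sum_(A : {set T} | A \subset U') (h A + k A).
  rewrite (eq_bigl (fun A => (A \subset U) && ((A != U) && (A != set0)))); last first.
    by move=> A; rewrite properEneq andbA (andbC (A != U)).
  rewrite big_mkcondr (sum_subsetD1 _ eU); apply: eq_bigr => A.
  rewrite subsetD1 => /andP[sA eA]; congr (_ + _).
    by have -> : A != U by apply: contraNneq eA => ->.
  have -> : e |: A != set0 by apply/set0Pn; exists e; rewrite setU11.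
  rewrite andbT /k cardsU1 eA add1n cU subSS.
  have -> : (e |: A != U) = (A != U'); last by [].
  by congr (~~ _); apply/eqP/eqP => [eAU|->]; rewrite ?/U' ?setD1K // -eAU setU1K.
rewrite /lincoef E1 (bigD1 U') //= {1}/k eqxx addr0.
rewrite {1}/h U'0 gU cU subSnn.
rewrite (eq_bigl (fun A : {set T} => A \proper U')); last first.
  by move=> A; rewrite properEneq andbC.
have hk A : A \proper U' -> h A + k A =
    (if A != set0 then g A * beta #|A|.-1 (#|U'| - #|A|).-1 else 0) +
    (g (e |: A) - g A) * beta #|A| (#|U'| - #|A|).-1.
  move=> pA; have := proper_card pA; have := pA; rewrite properEneq => /andP[nA _] cA.
  rewrite /h /k nA; case: ifPn => [A0|/negPn/eqP->]; last by rewrite g0 subr0.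
  have a0 : (0 < #|A|)%N by rewrite card_gt0.
  have -> : (#|U| - #|A|).-1 = (#|U'| - #|A|).-1.+1 by lia.
  rewrite -[in RHS](beta_pascal #|A|.-1 (#|U'| - #|A|).-1) !prednK ?subn_gt0 //.
  by ring.
rewrite (eq_bigr _ hk) big_split /= -big_mkcondr /=.
have -> : harmonic_number #|U'| = harmonic_number #|U'|.-1 + #|U'|%:R^-1.
  by rewrite -[in LHS](prednK m0) harmonicS prednK.
rewrite betaC beta0 prednK //; ring.
Qed.

Lemma eq_lincoef U (g h : {set T} -> rat) :
  (forall A, A \subset U -> g A = h A) -> lincoef U g = lincoef U h.
Proof.
move=> gh; rewrite /lincoef gh //; congr (_ - _); apply: eq_bigr => A.
by case/andP=> /proper_sub sA _; rewrite gh.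
Qed.

(** Deleting an element outside I changes nothing. Once U = I, deleting e leaves only the term of
    the empty set, of weight 1 / |U - e|, and these terms build up the harmonic number. *)
Lemma lincoef_simplex U (I : {set T}) : I \subset U -> I != set0 ->
  lincoef U (fun A => (A :&: I != set0)%:R) = harmonic_number #|I|.-1.
Proof.
have [m] := ubnP #|U|; elim: m U I => // m IH U I leU sIU I0.
have [eIU|nIU] := eqVneq I U; last first.
  have /properP[_ [e eU eI]] : I \proper U by rewrite properEneq nIU.
  have sI : I \subset U :\ e by rewrite subsetD1 sIU.
  have U'0 : U :\ e != set0.
    by apply: contraNneq I0 => E; rewrite E subset0 in sI.
  have cU : #|U| = #|U :\ e|.+1 by rewrite (cardsD1 e U) eU.
  rewrite (lincoef_delete eU U'0) ?set0I ?eqxx //; last first.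
    by rewrite (setIidPr sI) (setIidPr sIU).
  rewrite IH //; last by rewrite -ltnS -cU.
  rewrite big1 ?addr0 // => A _.
  have -> : (e |: A) :&: I = A :&: I.
    by apply/setP=> x; rewrite !inE; case: eqP => // ->; rewrite (negbTE eI) !andbF.
  by rewrite subrr mul0r.
rewrite eIU in I0 *; have [e eU] := set0Pn _ I0.
have cU : #|U| = #|U :\ e|.+1 by rewrite (cardsD1 e U) eU.
have [U'0|U'0] := eqVneq (U :\ e) set0.
  have -> : U = [set e] by rewrite -(setD1K eU) U'0 setU0.
  rewrite /lincoef cards1 harmonic0 mulr0 subr0 big_pred0 // => A.
  rewrite properEneq subset1; case: eqP => //= _.
  by case: eqP.
rewrite (lincoef_delete eU U'0) ?set0I ?eqxx //; last first.
  by rewrite (setIidPl (subsetDl _ _)) setIid U'0 I0.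
rewrite (@eq_lincoef _ _ (fun A => (A :&: (U :\ e) != set0)%:R)); last first.
  move=> A sA; rewrite (setIidPl sA) (setIidPl _) //.
  exact: subset_trans sA (subsetDl _ _).
rewrite IH //; last by rewrite -ltnS -cU.
rewrite (bigD1 set0) ?proper0 //= big1 ?addr0 => [|A /andP[pA A0]].
  have -> : (e |: set0) :&: U != set0.
    by apply/set0Pn; exists e; rewrite !inE eqxx eU.
  rewrite set0I eqxx cards0 subn0 subr0 mul1r beta0 cU /=.
  have m0 : (0 < #|U :\ e|)%N by rewrite card_gt0.
  by rewrite -{2}(prednK m0) -harmonicS !prednK.
have sA : A \subset U := subset_trans (proper_sub pA) (subsetDl _ _).
rewrite (setIidPl sA) A0 (setIidPl _) ?subUset ?sub1set ?eU //.
have -> : e |: A != set0 by apply/set0Pn; exists e; rewrite setU11.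
by rewrite subrr mul0r.
Qed.

(** For the simplex with I = U the function is 1 on nonempty sets, so its value H is the total
    weight minus H. *)
Lemma sum_weights U : U != set0 ->
  \sum_(A : {set T} | (A \proper U) && (A != set0))
     beta #|A|.-1 (#|U| - #|A|).-1 = 2 * harmonic_number #|U|.-1.
Proof.
move=> U0; have := lincoef_simplex (subxx U) U0.
rewrite /lincoef setIid U0 (eq_bigr (fun A : {set T} => beta #|A|.-1 (#|U| - #|A|).-1)).
  by move=> h; apply: (addIr (- (1 * harmonic_number #|U|.-1))); rewrite h; ring.
by move=> A /andP[/proper_sub/setIidPl -> ->]; rewrite mul1r.
Qed.

Lemma sum_weights_compl U (g : {set T} -> rat) :
  \sum_(A : {set T} | (A \proper U) && (A != set0))
     g (U :\: A) * beta #|A|.-1 (#|U| - #|A|).-1 =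
  \sum_(A : {set T} | (A \proper U) && (A != set0))
     g A * beta #|A|.-1 (#|U| - #|A|).-1.
Proof.
have DK (A : {set T}) : A \subset U -> U :\: (U :\: A) = A.
  by move=> sA; rewrite setDDr setDv set0U (setIidPr sA).
rewrite (reindex_onto (fun A => U :\: A) (fun A => U :\: A)) /=; last first.
  by move=> A /andP[/proper_sub sA _]; rewrite DK.
have P1 (A : {set T}) : (U :\: A \proper U) && (U :\: A != set0) &&
    (U :\: (U :\: A) == A) = (A \proper U) && (A != set0).
  have [sA|nA] := boolP (A \subset U); last first.
    rewrite [A \proper U]properE (negbTE nA) /=; apply/negbTE/negP => /andP[_ /eqP E].
    by rewrite -E subsetDl in nA.
  rewrite DK // eqxx andbT !properEneq sA subsetDl !andbT andbC; congr (~~ _ && ~~ _).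
    by rewrite setD_eq0 eqEsubset sA.
  apply/eqP/eqP => [E|->]; last by rewrite setD0.
  by rewrite -(DK _ sA) E setDv.
rewrite (eq_bigl _ _ P1); apply: eq_bigr => A /andP[/proper_sub sA _].
rewrite DK // cardsDS // subKn ?subset_leq_card //.
by rewrite betaC.
Qed.

(** The weights are invariant under complement. Hence the weighted sum of |A| is |U| H, with H the
    harmonic number of |U| - 1, and the total weight 2 H accounts for the constant g(U). *)
Lemma lincoef_dual U (g : {set T} -> rat) : U != set0 -> g set0 = 0 ->
  lincoef U (fun A => #|A|%:R + g (U :\: A) - g U) = lincoef U g.
Proof.
move=> U0 g0; set w := fun A : {set T} => beta #|A|.-1 (#|U| - #|A|).-1.
pose P (A : {set T}) := (A \proper U) && (A != set0).
have S := sum_weights U0; rewrite -/w in S.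
have C : \sum_(A | P A) #|A|%:R * w A = #|U|%:R * harmonic_number #|U|.-1.
  have : \sum_(A | P A) #|A|%:R * w A + \sum_(A | P A) #|U :\: A|%:R * w A =
     #|U|%:R * (2 * harmonic_number #|U|.-1).
    rewrite -S big_distrr -big_split; apply: eq_bigr => A /andP[/proper_sub sA _] /=.
    rewrite -mulrDl -natrD; congr (_%:R * _).
    by rewrite cardsDS // subnKC // subset_leq_card.
  rewrite (sum_weights_compl U (fun A => #|A|%:R)) -/w => h.
  by lra.
rewrite /lincoef setDv g0 addr0 (eq_bigr (fun A : {set T} =>
  #|A|%:R * w A + g (U :\: A) * w A - g U * w A)); last first.
  by move=> A _; rewrite /w; ring.
rewrite sumrB big_split /= C sum_weights_compl -mulr_sumr S.
by ring.
Qed.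

End SubsetSums.

(** * Rank functions and connectedness *)

Section RankFunctions.
Variable T : finType.
Implicit Types (U A B C D I P X Y Z W : {set T}) (e : T) (rho : {set T} -> nat).

Local Open Scope nat_scope.

Definition rank_function rho :=
  [/\ forall A, rho A <= #|A|,
      forall A B, A \subset B -> rho A <= rho B
    & forall A B, rho (A :|: B) + rho (A :&: B) <= rho A + rho B].

Definition rconnected U rho := [forall A : {set T},
  (A != set0) && (A \proper U) ==> (rho U < rho A + rho (U :\: A))].

(** The dual of the restriction to U. For a rank function the subtraction does not truncate, and
    elements outside U are free, so this is again a rank function on all subsets of T. *)
Definition dual_rank U rho A := #|A| + rho (U :\: A) - rho U.

Lemma rconnectedP U rho :
  reflect (forall A, A != set0 -> A \proper U -> rho U < rho A + rho (U :\: A))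
    (rconnected U rho).
Proof.
apply: (iffP forallP) => h A; first by move=> A0 pA; have := h A; rewrite A0 pA.
by apply/implyP => /andP[A0 pA]; apply: h.
Qed.

Lemma rconnectedPn U rho : ~~ rconnected U rho ->
  exists A, [/\ A != set0, A \proper U & rho A + rho (U :\: A) <= rho U].
Proof.
rewrite negb_forall => /existsP[A]; rewrite negb_imply -leqNgt.
by case/andP=> /andP[A0 pA] h; exists A.
Qed.

Section OneRankFunction.
Variable rho : {set T} -> nat.
Hypothesis rk : rank_function rho.

Lemma rank_set0 : rho set0 = 0.
Proof. by case: rk => h _ _; have := h set0; rewrite cards0; lia. Qed.

Lemma rankS A B : A \subset B -> rho A <= rho B.
Proof. by case: rk => _ h _; apply: h. Qed.

Lemma rank_le_card A : rho A <= #|A|.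
Proof. by case: rk. Qed.

Lemma rankU A B : rho (A :|: B) <= rho A + rho B.
Proof. by case: rk => _ _ h; have := h A B; lia. Qed.

Lemma rankU1 e A : rho (e |: A) <= (rho A).+1.
Proof. by have := rankU [set e] A; have := rank_le_card [set e]; rewrite cards1; lia. Qed.

Lemma rank_closure I Y : (forall x, x \in Y -> rho (x |: I) = rho I) ->
  rho (I :|: Y) = rho I.
Proof.
have [m] := ubnP #|Y|; elim: m Y => // m IH Y.
have [->|[e eY]] := set_0Vmem Y => leY hY; first by rewrite setU0.
have cY := cardsD1 e Y; rewrite eY add1n in cY.
have h1 : rho (I :|: Y :\ e) = rho I.
  by apply: IH => [|x /setD1P[_ xY]]; [lia | apply: hY].
have h2 := hY _ eY; case: rk => _ _ /(_ (I :|: Y :\ e) (e |: I)).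
have -> : (I :|: Y :\ e) :|: (e |: I) = I :|: Y.
  rewrite -[in RHS](setD1K eY) setUA setUAC -setUA setUC.
  by apply/setP => x; rewrite !inE; do !case: (_ \in _); do ?case: eqP.
have := rankS (_ : I \subset (I :|: Y :\ e) :&: (e |: I)).
rewrite subsetI subsetUl subsetUr => /(_ isT).
have := rankS (subsetUl I Y); lia.
Qed.

Lemma rank_indepS A B : A \subset B -> rho B = #|B| -> rho A = #|A|.
Proof.
move=> sAB hB; have := rankU A (B :\: A); have := rank_le_card (B :\: A).
have := rank_le_card A; rewrite setDE setUIr setUCr setIT (setUidPr sAB) -setDE.
by have := cardsDS sAB; have := subset_leq_card sAB; lia.
Qed.

Lemma rank_extend A U : A \subset U -> rho A = #|A| ->
  exists I, [/\ A \subset I, I \subset U, rho I = #|I| & #|I| = rho U].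
Proof.
move=> sAU hA.
pose Q (I : {set T}) := [&& A \subset I, I \subset U & rho I == #|I|].
have QA : Q A by rewrite /Q subxx sAU hA eqxx.
case: (arg_maxnP (fun I : {set T} => #|I|) QA) => I /and3P[sAI sIU /eqP hI] maxI.
exists I; split => //; rewrite -hI -[in RHS](setUidPr sIU) rank_closure // => x xU.
have [xI|xI] := boolP (x \in I); first by rewrite (setUidPr _) // sub1set.
have := rankS (subsetUr [set x] I); have := rankU1 x I.
suff : rho (x |: I) <> (rho I).+1 by lia.
move=> E; have := maxI (x |: I); rewrite /Q /= cardsU1 xI add1n E hI eqxx andbT => h.
suff : #|I| < #|I| by rewrite ltnn.
by apply: h; rewrite subUset sub1set xU sIU (subset_trans sAI) ?subsetUr.
Qed.

Lemma dual_rank_function U : rank_function (dual_rank U rho).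
Proof.
have D A : U = (U :&: A) :|: (U :\: A) by rewrite setID.
have le1 A : rho U <= #|A| + rho (U :\: A).
  have := rankU (U :&: A) (U :\: A); rewrite -D.
  by have := rank_le_card (U :&: A); have := subset_leq_card (subsetIr U A); lia.
split=> [A|A B sAB|A B]; rewrite /dual_rank.
- by have := rankS (subsetDl U A); lia.
- have := rankU ((U :\: A) :&: B) (U :\: B).
  have -> : (U :\: A) :&: B :|: U :\: B = U :\: A.
    apply/setP=> x; rewrite !inE; have := subsetP sAB x.
    by case: (x \in A); case: (x \in B); case: (x \in U) => //= /(_ isT).
  have := rank_le_card ((U :\: A) :&: B).
  have := subset_leq_card (_ : (U :\: A) :&: B \subset B :\: A).
  have -> : (U :\: A) :&: B \subset B :\: A.
    by apply/subsetP => x; rewrite !inE => /andP[/andP[-> _] ->].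
  by move=> /(_ isT); have := cardsDS sAB; have := subset_leq_card sAB; lia.
- case: rk => _ _ /(_ (U :\: A) (U :\: B)).
  rewrite -setDIr -setDUr; have := cardsUI A B.
  have := le1 A; have := le1 B; have := le1 (A :|: B); have := le1 (A :&: B); lia.
Qed.

Lemma dual_rankE U A : dual_rank U rho A + rho U = #|A| + rho (U :\: A).
Proof.
rewrite subnK //; have := rankU (U :&: A) (U :\: A); rewrite setID.
by have := rank_le_card (U :&: A); have := subset_leq_card (subsetIr U A); lia.
Qed.

Lemma dual_rankK U A : A \subset U ->
  dual_rank U (dual_rank U rho) A = rho A.
Proof.
move=> sA; have := rank_le_card U.
rewrite /dual_rank setDDr setDv set0U (setIidPr sA) rank_set0 cardsDS //.
have := subset_leq_card sA; have := rankU A (U :\: A).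
have := rank_le_card (U :\: A); rewrite cardsDS //.
rewrite setDE setUIr setUCr setIT (setUidPr sA); lia.
Qed.

Lemma rconnected_dual U : rconnected U rho -> rconnected U (dual_rank U rho).
Proof.
move=> /rconnectedP h; apply/rconnectedP => A A0 pA.
have sA := proper_sub pA.
have D0 : U :\: A != set0.
  by rewrite setD_eq0; move: pA; rewrite properE sA.
have pD : U :\: A \proper U.
  rewrite properEcard subsetDl cardsDS //; move: A0; rewrite -card_gt0.
  by have := subset_leq_card sA; lia.
have := h _ D0 pD.
have := dual_rankE U A; have := dual_rankE U (U :\: A); have := dual_rankE U U.
rewrite setDDr setDv set0U (setIidPr sA) rank_set0 cardsDS //.
by have := subset_leq_card sA; lia.
Qed.

Section Connected.
Variable U : {set T}.
Hypotheses (cU : rconnected U rho) (U2 : 1 < #|U|).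

(** A loop or a coloop would be a separator by itself. *)
Lemma rconnected_D1 e : e \in U -> rho [set e] = 1 /\ rho (U :\ e) = rho U.
Proof.
move=> eU; have sD : U :\ e \subset U by rewrite subsetDl.
have n0 : [set e] != set0 by rewrite -card_gt0 cards1.
have := rconnectedP _ _ cU _ n0; rewrite properEcard sub1set eU cards1 U2 => /(_ isT).
have := rank_le_card [set e]; rewrite cards1; have := rankS sD; lia.
Qed.

Lemma rconnected_rank_gt0 : 0 < rho U.
Proof.
have /card_gt0P[e eU] : 0 < #|U| by apply: ltnW.
have [e1 _] := rconnected_D1 eU; rewrite -e1; apply: rankS.
by rewrite sub1set.
Qed.

Lemma rconnected_rank_lt : rho U < #|U|.
Proof.
have /card_gt0P[e eU] : 0 < #|U| by apply: ltnW.
have [_ <-] := rconnected_D1 eU.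
by rewrite [ltnRHS](cardsD1 e) eU ltnS rank_le_card.
Qed.

(* Tutte: deleting e, or contracting e (which is deletion in the dual), preserves
   connectedness. *)
Lemma rconnected_delete e : e \in U ->
  rconnected (U :\ e) rho \/ rconnected (U :\ e) (dual_rank U rho).
Proof.
move=> eU; have [e1 re] := rconnected_D1 eU.
have [_|nc] := boolP (rconnected (U :\ e) rho); first by left.
have [_|nd] := boolP (rconnected (U :\ e) (dual_rank U rho)); first by right.
(* A and B separate the deletion, C and D the contraction; [hC] restates the latter in terms of
   [rho]. *)
have [A [A0 pA hAB]] := rconnectedPn nc; rewrite re in hAB; set B := U :\ e :\: A in hAB.
have [C [C0 pC hCD]] := rconnectedPn nd; set D := U :\ e :\: C in hCD.
have eD : U :\: C = e |: D.
  apply/setP=> x; rewrite !inE; case: eqP => [->|] //=.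
  by rewrite eU; have := subsetP (proper_sub pC) e; rewrite !inE eqxx /=; case: (e \in C) => // /(_ isT).
have eC : U :\: D = e |: C.
  apply/setP=> x; rewrite !inE; have := subsetP (proper_sub pC) x; rewrite !inE.
  case: eqP => [->|_] /=; first by rewrite eU andbF.
  by case: (x \in C) => [/(_ isT)->|_] //=; case: (x \in U).
have hC : rho (e |: C) + rho (e |: D) <= (rho U).+1.
  move: hCD; have := dual_rankE U C; have := dual_rankE U D.
  have := dual_rankE U (U :\ e); have -> : U :\: (U :\ e) = [set e].
    by apply/setP=> x; rewrite !inE; case: eqP => [->|_] /=; rewrite ?eU // andNb.
  rewrite e1 eC eD /D (cardsDS (proper_sub pC)).
  by have := subset_leq_card (proper_sub pC); lia.
have sC : C \subset U :\ e := proper_sub pC.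
have sD : D \subset U :\ e := subsetDl _ _.
have hB x : x \in U -> x != e -> (x \in B = (x \notin A)) * (x \in D = (x \notin C)).
  by move=> xU xe; rewrite !inE xU xe !andbT.
have out Z x : Z \subset U :\ e -> (x == e) || (x \notin U) -> x \in Z = false.
  move=> /subsetP/(_ x) sZ h; apply/negP => /sZ; rewrite !inE.
  by case: (x == e) h => //=; case: (x \in U).
(* If the opposite quadrants A :&: X and B :&: Y were both nonempty, connectedness at each of them
   would give at least 2 rho(U) + 2, while submodularity bounds the same sum by rho(A) + rho(B) +
   rho(e + X) + rho(e + Y), at most 2 rho(U) + 1. *)
have cross X Y : X \subset U :\ e -> Y \subset U :\ e ->
    (forall x, x \in U -> x != e -> x \in Y = (x \notin X)) ->
    rho (e |: X) + rho (e |: Y) <= (rho U).+1 ->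
    B :&: Y = set0 \/ A :&: X = set0.
  move=> sX sY XY h.
  have [->|BY0] := eqVneq (B :&: Y) set0; first by left.
  have [->|AX0] := eqVneq (A :&: X) set0; first by right.
  have sA := proper_sub pA.
  have propI Z W : Z \subset U :\ e -> Z :&: W \proper U.
    move=> sZ; apply/properP; split; last first.
      by exists e; rewrite // inE (out Z) ?eqxx.
    by rewrite (subset_trans (subsetIl _ _)) // (subset_trans sZ) // subsetDl.
  have sB : B \subset U :\ e by rewrite subsetDl.
  have := rconnectedP _ _ cU _ BY0 (propI _ Y sB).
  have := rconnectedP _ _ cU _ AX0 (propI _ X sA).
  have compl Z W Z' W' : Z \subset U :\ e -> W \subset U :\ e ->
      Z' \subset U :\ e -> W' \subset U :\ e ->
      (forall x, x \in U -> x != e -> x \in Z' = (x \notin Z)) ->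
      (forall x, x \in U -> x != e -> x \in W' = (x \notin W)) ->
      U :\: (Z :&: W) = Z' :|: (e |: W').
    move=> sZ sW sZ' sW' hZ hW; apply/setP => x; rewrite !inE.
    have [->|xe] /= := eqVneq x e; first by rewrite (out Z) ?eqxx // orbT eU.
    have [xU|xU] := boolP (x \in U); first by rewrite hZ // hW // negb_and andbT.
    by rewrite andbF (out Z') ?xU ?orbT // (out W') ?xU ?orbT.
  have hBA x : x \in U -> x != e -> x \in A = (x \notin B).
    by move=> xU xe; rewrite (hB _ xU xe).1 negbK.
  have hYX x : x \in U -> x != e -> x \in X = (x \notin Y).
    by move=> xU xe; rewrite XY // negbK.
  rewrite (compl A X B Y) //; last by move=> x xU xe; rewrite (hB _ xU xe).1.
  rewrite (compl B Y A X) //.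
  case: rk => _ _ sub; have := sub A (e |: X); have := sub B (e |: Y).
  have dI Z W : Z \subset U :\ e -> Z :&: (e |: W) = Z :&: W.
    move=> sZ; apply/setP=> x; rewrite !inE; case: eqP => [->|] //=.
    by rewrite (out Z) ?eqxx.
  rewrite !dI //; move: hAB h; clear; lia.
have disj2 X Y Z : X \subset U :\ e -> X :&: Y = set0 -> X :&: Z = set0 ->
   (forall x, x \in U -> x != e -> (x \in Y) || (x \in Z)) -> X = set0.
  move=> sX /setP XY /setP XZ hYZ; apply/setP=> x; rewrite inE; apply/negbTE/negP => xX.
  have := subsetP sX _ xX; rewrite !inE => /andP[xe xU].
  by have := hYZ x xU xe; have := XY x; have := XZ x; rewrite !inE xX /= => -> ->.
exfalso; have sA := proper_sub pA; have sB : B \subset U :\ e := subsetDl _ _.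
have B0 : B != set0 by rewrite setD_eq0; case/andP: pA.
have D0 : D != set0 by rewrite setD_eq0; case/andP: pC.
have orCD x : x \in U -> x != e -> (x \in C) || (x \in D).
  by move=> xU xe; rewrite (hB _ xU xe).2 orbN.
have orAB x : x \in U -> x != e -> (x \in A) || (x \in B).
  by move=> xU xe; rewrite (hB _ xU xe).1 orbN.
have orDC x : x \in U -> x != e -> (x \in D) || (x \in C).
  by move=> xU xe; rewrite orbC orCD.
have hDC x : x \in U -> x != e -> x \in D = (x \notin C).
  by move=> xU xe; rewrite (hB _ xU xe).2.
have hCD' x : x \in U -> x != e -> x \in C = (x \notin D).
  by move=> xU xe; rewrite hDC // negbK.
have hC' : rho (e |: D) + rho (e |: C) <= (rho U).+1 by rewrite addnC.
(* One quadrant on each diagonal is empty; two such quadrants are adjacent and fill one of A, B, C,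
   D. *)
case: (cross C D sC sD hDC hC) => E1; case: (cross D C sD sC hCD' hC') => E2.
- by move: B0; rewrite (disj2 B D C) ?eqxx.
- by move: D0; rewrite (disj2 D A B) ?eqxx // setIC.
- by move: C0; rewrite (disj2 C A B) ?eqxx // setIC.
- by move: A0; rewrite (disj2 A C D) ?eqxx.
Qed.
End Connected.
End OneRankFunction.
End RankFunctions.

(** * The lower bound *)

Definition minimal_coef (r n : nat) : rat :=
  harmonic_number r.-1 + harmonic_number (n - r).-1 + beta r.-1 (n - r).-1.

(** The increment is the bound of [delete_gap] for one deletion, and also what one more parallel
    element adds in [lincoef_minimal_delete]; both keep r fixed. *)
Lemma minimal_coef_rec r n : (0 < r < n)%N ->
  minimal_coef r n.+1 =
  minimal_coef r n + ((n - r)%:R^-1 - beta r (n - r).-1).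
Proof.
move=> /andP[r0 rn]; rewrite /minimal_coef subSn ?(ltnW rn) //=.
have nr0 : (0 < n - r)%N by rewrite subn_gt0.
rewrite -[in harmonic_number (n - r)](prednK nr0) harmonicS prednK //.
rewrite -[in beta r.-1 (n - r).-1](beta_pascal r.-1) !prednK //.
by ring.
Qed.

Lemma minimal_coef_sym r n : (r <= n)%N -> minimal_coef (n - r) n = minimal_coef r n.
Proof.
by move=> rn; rewrite /minimal_coef subKn // betaC [harmonic_number (n - r).-1 + _]addrC.
Qed.

Section Gap.
Variable T : finType.
Implicit Types (U A B C D I P R X Y Z W : {set T}) (e : T) (rho : {set T} -> nat).

(* The rank function on U of a minimal matroid whose large parallel class is P;
   exchanging P and U :\: P gives the dual. *)
Definition minimal_rank U P rho := P \subset U /\ forall A, A \subset U ->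
  rho A = if A :&: P == set0 then #|A| else minn #|A :\: P|.+1 #|U :\: P|.

Section OneRankFunction.
Variables (rho : {set T} -> nat) (U : {set T}).
Hypotheses (rk : rank_function rho) (cU : rconnected U rho).

Section Delete.
Variable e : T.
Hypotheses (eU : e \in U) (cU' : rconnected (U :\ e) rho) (U3 : (2 < #|U|)%N).

Let m := #|U :\ e|.
Let r := rho U.

(** Extend e to a basis e + B of U. If X misses b in B, the independent set e + B - b extends by
    some g to a basis avoiding b, because b is not a coloop; this basis contains e + g + X. *)
Lemma delete_basis : exists B : {set T},
  [/\ B \subset U :\ e, #|B|.+1 = r, rho (e |: B) = r &
   forall X, X \proper B -> exists g,
     [/\ g \in U :\ e, g \notin B & (rho (g |: X) < rho (e |: (g |: X)))%N]].
Proof.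
have [e1 re] := rconnected_D1 rk cU (ltnW U3) eU.
have hs : [set e] \subset U by rewrite sub1set.
have he : rho [set e] = #|[set e]| by rewrite cards1.
have [I [eI sIU hI cI]] := rank_extend rk hs he; rewrite sub1set in eI.
have cB := cardsD1 e I; rewrite eI add1n in cB.
exists (I :\ e); split; rewrite ?setD1K ?hI -?cB //; first exact: setSD.
move=> X /properP[sXB [b bB bX]].
have bI : b \in I by move: bB; rewrite inE => /andP[].
have be : e != b by move: bB; rewrite !inE eq_sym => /andP[].
have [_ rb] := rconnected_D1 rk cU (ltnW U3) (subsetP sIU _ bI).
have hJ : rho (I :\ b) = #|I :\ b| by apply: rank_indepS hI => //; exact: subsetDl.
have [K [sJK sKU hK cK]] := rank_extend rk (setSD [set b] sIU) hJ.
have cJ := cardsD1 b I; rewrite bI add1n in cJ.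
have /subsetPn[g gK gJ] : ~~ (K \subset I :\ b).
  by apply/negP => /subset_leq_card; rewrite cK rb -cI cJ ltnn.
have gb : g != b by have := subsetP sKU _ gK; rewrite !inE => /andP[].
have gI : g \notin I by move: gJ; rewrite !inE gb.
have ge : g != e by apply: contraNneq gI => ->.
have sub : e |: (g |: X) \subset K.
  rewrite !subUset !sub1set gK (subsetP sJK) ?inE ?be ?eI //=.
  apply: subset_trans sJK; rewrite subsetD1 bX andbT.
  exact: subset_trans sXB (subsetDl _ _).
exists g; split.
- by rewrite !inE ge; have := subsetP sKU _ gK; rewrite inE => /andP[].
- by rewrite !inE (negbTE gI) andbF.
have eX : e \notin g |: X.
  rewrite !inE eq_sym (negbTE ge) /=; apply: contraTN sXB => eX.
  by apply/subsetPn; exists e; rewrite // !inE eqxx.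
by rewrite (rank_indepS rk sub hK) cardsU1 eX add1n ltnS (rank_le_card rk).
Qed.

Let deletion_sum := \sum_(A : {set T} | A \proper U :\ e)
  ((rho (e |: A))%:R - (rho A)%:R) * beta #|A| (m - #|A|).-1.
Let gap : rat := (m - r)%:R^-1 - beta r (m - r).-1.

Lemma delete_gap :
  gap <= deletion_sum /\ (deletion_sum = gap -> exists R : {set T}, [/\ R \subset U :\ e, #|R| = r &
     forall f, f \in U :\ e -> f \notin R -> (rho [set e; f] <= 1)%N]).
Proof.
have [B [sB cB rB hB]] := delete_basis.
have [_ re] := rconnected_D1 rk cU (ltnW U3) eU.
have cUm : #|U| = m.+1 by rewrite /m (cardsD1 e U) eU.
have rm : (r < m)%N by rewrite /r -re; apply: rconnected_rank_lt => //; rewrite -ltnS -cUm.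
pose v A := beta #|A| (m - #|A|).-1.
pose F := [set A : {set T} | (A \proper U :\ e) && (rho A < rho (e |: A))%N].
have sumF : deletion_sum = \sum_(A in F) v A.
  rewrite /deletion_sum (bigID (fun A => (rho A < rho (e |: A))%N)) /=.
  rewrite [X in _ + X]big1 ?addr0 => [|A /andP[_ nA]].
    apply: eq_big => [A|A /andP[_ hA]]; first by rewrite inE.
    have := rankU1 rk e A => hA'; have -> : rho (e |: A) = (rho A).+1.
      by apply/eqP; rewrite eqn_leq hA hA'.
    by rewrite -natr1 addrAC subrr add0r mul1r.
  have -> : rho (e |: A) = rho A; last by rewrite subrr mul0r.
  by apply/eqP; rewrite eqn_leq leqNgt nA (rankS rk) ?subsetUr.
have Fprop A : A \subset U :\ e -> (#|A| <= r)%N -> A \proper U :\ e.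
  by move=> sA cA; rewrite properEcard sA (leq_ltn_trans cA).
pose good X g := [&& g \in U :\ e, g \notin B & (rho (g |: X) < rho (e |: (g |: X)))%N].
(* The element g comes from [delete_basis], so the default X occurs only outside the proper subsets
   of B. As g is not in B, X is recovered as h X :&: B, which makes [h] injective there. *)
pose h X := if [pick g | good X g] is Some g then g |: X else X.
have hP X : X \proper B -> exists g, [/\ h X = g |: X, g \in U :\ e, g \notin B & h X \in F].
  move=> pX; rewrite /h; case: pickP => [g /and3P[gU gB hg]|nog]; last first.
    by have [g [gU gB hg]] := hB _ pX; have := nog g; rewrite /good gU gB hg.
  exists g; split; rewrite // inE hg andbT Fprop //.
    by rewrite subUset sub1set gU (subset_trans (proper_sub pX)).
  by rewrite cardsU1 -cB; have := proper_card pX; case: (g \notin X) => /=; lia.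
have hI X : X \proper B -> h X :&: B = X.
  move=> pX; have [g [-> _ gB _]] := hP X pX.
  rewrite setIUl (setIidPl (proper_sub pX)); apply/setUidPr/subsetP => x.
  by rewrite !inE => /andP[/eqP-> gB']; rewrite gB' in gB.
pose Q1 := powerset B; pose Q2 := h @: [set X : {set T} | X \proper B].
have Q2P A : reflect (exists2 X : {set T}, X \proper B & A = h X) (A \in Q2).
  by apply: (iffP imsetP) => -[X pX ->]; exists X; rewrite // inE in pX *.
have disQ : [disjoint Q1 & Q2].
  rewrite disjoint_subset; apply/subsetP => A; rewrite !inE => sA; apply/Q2P => -[X pX eA].
  have [g [hX _ gB _]] := hP X pX; move/subsetP: sA => /(_ g).
  by rewrite eA hX setU11 (negbTE gB) => /(_ isT).
have Q1F A : A \subset B -> A \in F.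
  move=> sA; rewrite inE Fprop ?(subset_trans sA) //; last first.
    by rewrite -cB (leq_trans (subset_leq_card sA)).
  have eB : e \notin B by apply/negP => /(subsetP sB); rewrite !inE eqxx.
  have eA : e \notin A by apply: contra eB; apply: (subsetP sA).
  have -> : rho (e |: A) = #|e |: A|.
    by apply: (rank_indepS rk (setUS [set e] sA)); rewrite rB cardsU1 eB.
  by rewrite cardsU1 eA ltnS (rank_le_card rk).
have QF : Q1 :|: Q2 \subset F.
  apply/subsetP => A; rewrite inE => /orP[|/Q2P[X pX ->]].
    by rewrite inE; apply: Q1F.
  by have [g [_ _ _ ->]] := hP X pX.
(* By [beta_pascal] the weights of X and h X merge into the summand of [sum_beta_subset]. Only X = B
   has no partner, and the missing term is [beta r (m - r).-1]. *)
have sumQ : \sum_(A in Q1 :|: Q2) v A = gap.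
  have -> : \sum_(A in Q1 :|: Q2) v A = \sum_(A in Q1) v A + \sum_(A in Q2) v A.
    by rewrite -bigU //; apply: eq_bigl => A; rewrite in_setU.
  rewrite [X in _ + X]big_imset /=; last first.
    by move=> X Y; rewrite !inE => /hI {2}<- /hI {2}<- ->.
  have b1 X : X \subset B -> (m - #|X|).-1 = ((m - r).-1 + (#|B| - #|X|)).+1.
    by move=> /subset_leq_card; lia.
  rewrite (eq_bigl (fun X : {set T} => X \subset B)); last by move=> X; rewrite inE.
  rewrite [X in _ + X](eq_big (fun X : {set T} => (X \subset B) && (X != B))
    (fun X => beta #|X|.+1 ((m - r).-1 + (#|B| - #|X|)))); last first.
  - move=> X; rewrite inE => pX; have [g [hX _ gB _]] := hP X pX.
    rewrite /v hX cardsU1; have -> : g \notin X by apply: contra gB; apply/subsetP/proper_sub.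
    have := b1 X (proper_sub pX); have := proper_card pX.
    by rewrite add1n => ? ?; congr beta; lia.
  - by move=> X; rewrite inE properEneq andbC.
  rewrite /gap; have -> : (m - r)%:R^-1 = (m - r).-1.+1%:R^-1 :> rat by rewrite prednK // subn_gt0.
  rewrite -(sum_beta_subset B).
  rewrite [X in _ = X - _](eq_bigr (fun X : {set T} =>
     beta #|X|.+1 ((m - r).-1 + (#|B| - #|X|)) + v X)); last first.
    by move=> X sX; rewrite /v (b1 X sX) beta_pascal.
  rewrite big_split /= [X in _ = X + _ - _](bigD1 B) //= subnn addn0 cB; ring.
rewrite sumF (big_setID (Q1 :|: Q2)) /= (setIidPr QF) sumQ.
have v0 A : 0 < v A by apply: beta_gt0.
split; first by rewrite lerDl sumr_ge0 // => A _; apply: ltW.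
move=> /eqP; rewrite -subr_eq0 addrAC subrr add0r psumr_eq0 => [/allP F0|A _]; last exact: ltW.
have {F0}FQ A : A \in F -> A \in Q1 :|: Q2.
  move=> AF; apply/negPn/negP => nQ; have := F0 A (mem_index_enum _).
  by rewrite inE nQ AF /= gt_eqF.
(* In rank one B is empty and has no proper subset to provide g, but all elements are parallel to e
   and any singleton serves as R. *)
have [r1|r1] := leqP r 1.
  have : (0 < m)%N by lia.
  rewrite card_gt0 => /set0Pn[f fU]; exists [set f]; split.
  - by rewrite sub1set.
  - by rewrite cards1; have := rconnected_rank_gt0 rk cU (ltnW U3); rewrite -/r; lia.
  move=> f' fU' _; apply: leq_trans r1; apply: (rankS rk).
  move: fU'; rewrite !inE => /andP[_ fU'].
  by rewrite subUset !sub1set eU fU'.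
have B0 : set0 \proper B by rewrite proper0 -card_gt0; lia.
have [g [h0 gU gB _]] := hP _ B0; rewrite setU0 in h0.
exists (g |: B); split.
- by rewrite subUset sub1set gU.
- by rewrite cardsU1 gB.
(* If f were not parallel to e, the set {f} would not span e and so would lie in one of the two
   families. It is not inside B, and h X = {f} forces X empty, whence f = g. *)
move=> f fU; rewrite !inE negb_or => /andP[fg fB]; rewrite leqNgt; apply/negP => ef.
have : [set f] \in F.
  rewrite inE Fprop ?sub1set ?cards1 ?(ltnW r1) //=.
  by apply: leq_trans ef; rewrite ltnS (leq_trans (rank_le_card rk _)) ?cards1.
move/FQ; rewrite !inE sub1set (negbTE fB) /= => /Q2P[X pX hX].
have X0 : X = set0.
  by rewrite -(hI _ pX) -hX; apply/setP=> x; rewrite !inE; case: eqP => // ->; apply/negbTE.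
by move: hX; rewrite X0 h0 => /set1_inj/eqP; rewrite (negbTE fg).
Qed.
End Delete.
End OneRankFunction.
End Gap.

(** * Rank functions of minimal matroids and the case of equality *)

Section MinimalRank.
Variable T : finType.
Implicit Types (U A B C D I P R X Y Z W : {set T}) (e : T) (rho : {set T} -> nat).

(** P = U - R has rank one, so R is independent, lest P and R separate U. No x in R is a coloop, so
    U - x has full rank, and e + R - x, which spans it, is independent. These facts determine every
    rank. *)
Lemma minimal_rank_intro rho U e R : rank_function rho -> rconnected U rho ->
  (1 < #|U|)%N -> e \in U -> R \subset U :\ e -> #|R| = rho U ->
  (forall f, f \in U :\ e -> f \notin R -> (rho [set e; f] <= 1)%N) ->
  minimal_rank U (U :\: R) rho.
Proof.
move=> rk cU U2 eU sR cR par; split; first exact: subsetDl.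
have [e1 _] := rconnected_D1 rk cU U2 eU.
have sRU : R \subset U := subset_trans sR (subsetDl _ _).
have eR : e \notin R by apply/negP => /(subsetP sR); rewrite !inE eqxx.
have rP : rho (e |: (U :\: R)) = 1%N.
  rewrite rank_closure // => f /setDP[fU fR]; have [->|fe] := eqVneq f e.
    by rewrite setUid.
  have := par f; rewrite !inE fe => /(_ fU fR); rewrite setUC.
  have := rankS rk (subsetUr [set f] [set e]); rewrite e1; lia.
have eP : e |: (U :\: R) = U :\: R by apply/setUidPr; rewrite sub1set inE eR.
rewrite eP in rP.
have pP : U :\: R \proper U.
  rewrite properEcard subsetDl cardsDS // cR.
  by have := rconnected_rank_gt0 rk cU U2; have := rconnected_rank_lt rk cU U2; lia.
have P0 : U :\: R != set0 by apply/set0Pn; exists e; rewrite inE eR.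
have DR : U :\: (U :\: R) = R by rewrite setDDr setDv set0U; apply/setIidPr.
have rR : rho R = #|R|.
  have := rconnectedP _ _ cU _ P0 pP; rewrite rP DR.
  by have := rank_le_card rk R; lia.
have closeP p X Y : p \in U :\: R -> p \in X -> Y \subset U :\: R -> rho (X :|: Y) = rho X.
  move=> pPr pX sY; apply: rank_closure => // y yY.
  have [_ _ sub] := rk; have := sub X [set p; y].
  have -> : X :|: [set p; y] = y |: X.
    by apply/setP=> x; rewrite !inE; case: eqP => [->|] /=; rewrite ?pX ?orbT // orbC.
  have : (rho [set p; y] <= 1)%N.
    by rewrite -rP (rankS rk) // subUset !sub1set pPr (subsetP sY).
  have : (rho [set p] <= rho (X :&: [set p; y]))%N.
    by rewrite (rankS rk) // sub1set !inE pX eqxx.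
  have pU : p \in U by case/setDP: pPr.
  rewrite (rconnected_D1 rk cU U2 pU).1; have := rankS rk (subsetUr [set y] X).
  by clear; lia.
move=> A sA; have [A0|/set0Pn[p]] := eqVneq (A :&: (U :\: R)) set0.
  apply: (rank_indepS rk _ rR); apply/subsetP => x xA; apply/negPn/negP => xR.
  by move/setP: A0 => /(_ x); rewrite !inE xA xR (subsetP sA).
rewrite inE => /andP[pA pPr].
have eA : rho A = rho (e |: (A :\: (U :\: R))).
  have e_in : e \in U :\: R by rewrite inE eR.
  rewrite -(closeP e (e |: _) (A :&: (U :\: R))) ?subsetIr ?setU11 //.
  rewrite -setUA [_ :|: (A :&: _)]setUC setID.
  by rewrite setUC (closeP p) // sub1set.
rewrite eA DR; set X := A :\: _.
have sX : X \subset R.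
  apply/subsetP => x; rewrite !inE => /andP[nx xA].
  by move: nx; rewrite (subsetP sA) // andbT negbK.
have := subset_leq_card sX => cX.
have [XR|nXR] := eqVneq X R.
  rewrite XR (minn_idPr _) //; apply/eqP; rewrite eqn_leq {1}cR (rankS rk) /=; last first.
    by rewrite subUset sub1set eU.
  by rewrite -rR (rankS rk) // subsetUr.
have /properP[_ [x xR xX]] : X \proper R by rewrite properEneq nXR.
have cX' : (#|X| < #|R|)%N by rewrite proper_card // properEneq nXR.
rewrite (minn_idPl cX').
have rx : rho (e |: R :\ x) = #|e |: R :\ x|.
  have e_in : e \in U :\: R by rewrite inE eR.
  rewrite -(closeP e _ (U :\: R)) ?setU11 //.
  have -> : (e |: R :\ x) :|: (U :\: R) = U :\ x.
    apply/setP => y; rewrite !inE; case: (eqVneq y e) => [->|_] /=.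
      by rewrite eU andbT; apply/esym; apply: contraNneq eR => ->.
    have [yR|yR] := boolP (y \in R); first by rewrite (subsetP sRU) ?orbF.
    by rewrite andbF /=; case: eqP yR => [->|//]; rewrite xR.
  have xU : x \in U by apply: (subsetP sRU).
  rewrite (rconnected_D1 rk cU U2 xU).2 cardsU1 -cR (cardsD1 x R) xR.
  by rewrite !inE (negbTE eR) andbF.
have sx : e |: X \subset e |: R :\ x by rewrite setUS // subsetD1 sX.
rewrite (rank_indepS rk sx rx) cardsU1.
by have -> : e \notin X by apply: contra eR; apply: (subsetP sX).
Qed.

Lemma minimal_rank_dual rho U P : rank_function rho -> P != set0 ->
  minimal_rank U P rho -> minimal_rank U (U :\: P) (dual_rank U rho).
Proof.
move=> rk P0 [sP hP]; split=> [|A sA]; first exact: subsetDl.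
have := dual_rankE rk U A; rewrite !hP ?subsetDl //.
have c1 := cardsID P A.
have c2 : (#|A :&: P| + #|(U :\: A) :&: P| = #|P|)%N.
  rewrite -(cardsID A P) setIC; congr (_ + _)%N; apply: eq_card => x; rewrite !inE.
  by have := subsetP sP x; case: (x \in P) => [->|]; rewrite ?andbT ?andbF.
have c3 : (#|A :\: P| + #|U :\: A :\: P| = #|U :\: P|)%N.
  rewrite -(cardsID A (U :\: P)); congr (_ + _)%N; apply: eq_card => x; rewrite !inE.
    by have := subsetP sA x; case: (x \in A) => [->|]; rewrite ?andbT ?andbF.
  by case: (x \in A); case: (x \in P).
have c4 : (#|A| + #|U :\: A| = #|U|)%N by rewrite -(cardsID A U) (setIidPr sA).
have c5 : (#|P| + #|U :\: P| = #|U|)%N by rewrite -(cardsID P U) (setIidPr sP).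
have -> : A :&: (U :\: P) = A :\: P by rewrite setIDA (setIidPl sA).
have -> : A :\: (U :\: P) = A :&: P.
  by rewrite setDDr; move: sA; rewrite -setD_eq0 => /eqP->; rewrite set0U.
have -> : U :\: (U :\: P) = P by rewrite setDDr setDv set0U; apply/setIidPr.
rewrite (setIidPr sP) (negbTE P0) -!cards_eq0.
move: P0; rewrite -card_gt0; move: c1 c2 c3 c4 c5; clear.
by do 2!case: eqP; lia.
Qed.

Lemma minimal_rank_delete rho U P e : e \in P -> minimal_rank U P rho ->
  minimal_rank (U :\ e) (P :\ e) rho.
Proof.
move=> eP [sP hP]; split=> [|A]; first exact: setSD.
rewrite subsetD1 => /andP[sA eA]; rewrite hP //.
have -> : A :&: (P :\ e) = A :&: P.
  by apply/setP=> x; rewrite !inE; case: eqP => // ->; rewrite (negbTE eA).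
have -> : A :\: (P :\ e) = A :\: P.
  by apply/setP=> x; rewrite !inE; case: eqP => // ->; rewrite (negbTE eA) !andbF.
have -> // : U :\ e :\: (P :\ e) = U :\: P.
by apply/setP=> x; rewrite !inE; case: eqP => // ->; rewrite eP.
Qed.

(** Among the proper subsets of U - e, adding e raises the rank exactly for the proper subsets of U
    - P; by [sum_beta_proper] their weights give the increment of [minimal_coef_rec]. *)
Lemma lincoef_minimal_delete rho U P e : e \in P -> P :\ e != set0 ->
  U :\: P != set0 -> minimal_rank U P rho ->
  lincoef (U :\ e) (fun A => (rho A)%:R) = minimal_coef #|U :\: P| #|U :\ e| ->
  lincoef U (fun A => (rho A)%:R) = minimal_coef #|U :\: P| #|U|.
Proof.
move=> eP P0 R0 hmin IH; have [sP hP] := hmin.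
have eU := subsetP sP _ eP.
have cU : #|U| = #|U :\ e|.+1 by rewrite (cardsD1 e U) eU.
have sPU : P :\ e \subset U :\ e := setSD _ sP.
have cP : (#|P :\ e| + #|U :\: P| = #|U :\ e|)%N.
  rewrite -(cardsID (P :\ e) (U :\ e)) (setIidPr sPU); congr (_ + _)%N.
  by apply: eq_card => x; rewrite !inE; case: eqP => // ->; rewrite eP.
move: (P0) (R0); rewrite -!card_gt0 => p0 r0.
have U'0 : U :\ e != set0 by rewrite -card_gt0; lia.
have h0 : rho set0 = 0%N by rewrite hP ?sub0set // set0I eqxx cards0.
have hU : rho U = #|U :\: P|.
  rewrite hP // (setIidPr sP) ifN; first exact/minn_idPr/leqnSn.
  by apply/set0Pn; exists e.
have hU' : rho (U :\ e) = #|U :\: P|.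
  have [_ ->] := minimal_rank_delete eP hmin; rewrite // (setIidPr sPU) (negbTE P0).
  have -> : U :\ e :\: (P :\ e) = U :\: P.
    by apply/setP=> x; rewrite !inE; case: eqP => // ->; rewrite eP.
  exact/minn_idPr/leqnSn.
rewrite (lincoef_delete eU U'0) ?h0 ?hU ?hU' // IH cU minimal_coef_rec; last lia.
congr (_ + _); set m := #|U :\ e| in cP *; set r := #|U :\: P| in cP r0 *.
have d A : A \proper U :\ e -> (rho (e |: A))%:R - (rho A)%:R =
    (A \proper U :\: P)%:R :> rat.
  move=> /proper_sub; rewrite subsetD1 => /andP[sA eA].
  rewrite !hP ?subUset ?sub1set ?eU //.
  have -> : (e |: A) :&: P == set0 = false.
    by apply/negbTE/set0Pn; exists e; rewrite !inE eqxx eP.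
  have -> : (e |: A) :\: P = A :\: P.
    by apply/setP=> x; rewrite !inE; case: eqP => // ->; rewrite eP.
  have [A0|A0] := eqVneq (A :&: P) set0; last first.
    rewrite subrr; have -> // : A \proper U :\: P = false.
    apply/negP => /proper_sub; rewrite subsetD -setI_eq0 => /andP[_].
    by rewrite (negbTE A0).
  have AP : A :\: P = A by apply/setDidPl; rewrite -setI_eq0 A0.
  have sAR : A \subset U :\: P by rewrite -AP setSD.
  rewrite AP properEcard sAR /= -/r; have := subset_leq_card sAR; rewrite -/r leq_eqVlt.
  case/predU1P => [->|h]; last by rewrite h (minn_idPl h) -natr1 addrAC subrr add0r.
  by rewrite ltnn (minn_idPr _) ?subrr.
rewrite (eq_bigr (fun A : {set T} => if A \proper U :\: P then
   beta #|A| ((m - r).-1 + (r - #|A|)) else 0)); last first.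
  move=> A pA; rewrite d //; case: ifP => [pR|_]; last by rewrite mul0r.
  by rewrite mul1r; congr beta; have := proper_card pR; rewrite -/r; move: cP p0; rewrite -/m -/r; clear; lia.
rewrite -big_mkcondr /= (eq_bigl (fun A : {set T} => A \proper U :\: P)); last first.
  move=> A; rewrite andb_idl // => pA; apply: (proper_sub_trans pA).
  by apply/subsetP => x; rewrite !inE => /andP[xP ->]; rewrite andbT; apply: contraNneq xP => ->.
by rewrite sum_beta_proper prednK // subn_gt0 -cP -[X in (X < _)%N]add0n ltn_add2r.
Qed.

(** A class P of at least two elements is shortened by deletion; a class of one element is exchanged
    with its complement by duality. This ends at two elements. *)
Lemma lincoef_minimal rho U P : rank_function rho -> P != set0 -> U :\: P != set0 ->
  minimal_rank U P rho ->
  lincoef U (fun A => (rho A)%:R) = minimal_coef #|U :\: P| #|U|.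
Proof.
have [n] := ubnP #|U|; elim: n rho U P => // n IH rho U P leU rk P0 R0 hmin.
have del rho' P' : rank_function rho' -> (1 < #|P'|)%N -> U :\: P' != set0 ->
    minimal_rank U P' rho' ->
    lincoef U (fun A => (rho' A)%:R) = minimal_coef #|U :\: P'| #|U|.
  move=> rk' P2 R0' hmin'.
  have /card_gt0P[e eP] : (0 < #|P'|)%N by apply: ltnW.
  have P'0 : P' :\ e != set0 by move: P2; rewrite (cardsD1 e P') eP ltnS card_gt0.
  apply: (lincoef_minimal_delete eP) => //.
  have E : U :\ e :\: (P' :\ e) = U :\: P'.
    by apply/setP=> x; rewrite !inE; case: eqP => // ->; rewrite eP.
  have sP' : P' \subset U by case: hmin'.
  rewrite -E; apply: IH; rewrite ?E //; last exact: minimal_rank_delete.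
  by move: leU; rewrite (cardsD1 e U) (subsetP sP' _ eP).
have [sP hP] := hmin; have DP : U :\: (U :\: P) = P.
  by rewrite setDDr setDv set0U; apply/setIidPr.
have cP : (#|P| + #|U :\: P| = #|U|)%N by rewrite -(cardsID P U) (setIidPr sP).
have hU : rho U = #|U :\: P|.
  by rewrite hP // (setIidPr sP) (negbTE P0); exact/minn_idPr/leqnSn.
have [P1|P2] := leqP #|P| 1; last exact: del.
have U0 : U != set0 by apply: contraNneq P0 => U0; rewrite U0 subset0 in sP.
have [R1|R2] := leqP #|U :\: P| 1; last first.
  have rk' := dual_rank_function rk U.
  have := del _ (U :\: P) rk' R2; rewrite DP => /(_ P0 (minimal_rank_dual rk P0 hmin)).
  rewrite -{1}[#|P|](addnK #|U :\: P|) cP minimal_coef_sym; last by rewrite -cP leq_addl.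
  move=> <-; rewrite -(lincoef_dual (g := fun A => (rho A)%:R)) ?(rank_set0 rk) //.
  by apply: eq_lincoef => A _; rewrite -natrD -(dual_rankE rk) natrD addrK.
have U2 : #|U| = 2.
  by move: P0 R0; rewrite -!card_gt0; lia.
have R1' : #|U :\: P| = 1%N by move: R0; rewrite -card_gt0; lia.
rewrite /lincoef hU R1' U2 /minimal_coef /= harmonic0 beta0.
rewrite (eq_bigr (fun A : {set T} => beta #|A|.-1 (#|U| - #|A|).-1)).
  by rewrite sum_weights // U2 harmonicS harmonic0; ring.
move=> A /andP[pA A0]; have sA := proper_sub pA.
have cA : #|A| = 1%N.
  by have := proper_card pA; rewrite U2; move: A0; rewrite -card_gt0; lia.
rewrite cA U2 hP //; case: ifP => _; rewrite ?cA ?mul1r //.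
by rewrite R1' (minn_idPr _) ?mul1r.
Qed.

Theorem lincoef_ge_minimal rho U : rank_function rho -> rconnected U rho ->
  (1 < #|U|)%N ->
  minimal_coef (rho U) #|U| <= lincoef U (fun A => (rho A)%:R) /\
  (lincoef U (fun A => (rho A)%:R) = minimal_coef (rho U) #|U| ->
   exists P, #|U :\: P| = rho U /\ minimal_rank U P rho).
Proof.
have [n] := ubnP #|U|; elim: n rho U => // n IH rho U leU rk cU U2.
have step rho' e : e \in U -> rank_function rho' -> rconnected U rho' ->
    rconnected (U :\ e) rho' -> (2 < #|U|)%N ->
    minimal_coef (rho' U) #|U| <= lincoef U (fun A => (rho' A)%:R) /\
    (lincoef U (fun A => (rho' A)%:R) = minimal_coef (rho' U) #|U| ->
     exists P, #|U :\: P| = rho' U /\ minimal_rank U P rho').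
  move=> eU rk' cU' cUe U3.
  have cE : #|U| = #|U :\ e|.+1 by rewrite (cardsD1 e U) eU.
  have U'2 : (1 < #|U :\ e|)%N by rewrite -ltnS -cE.
  have [_ re] := rconnected_D1 rk' cU' U2 eU.
  have U'0 : U :\ e != set0 by rewrite -card_gt0 ltnW.
  have [IH1 _] := IH rho' (U :\ e) ltac:(by rewrite -ltnS -cE) rk' cUe U'2.
  have [gap1 gap2] := delete_gap rk' cU' eU cUe U3.
  rewrite (lincoef_delete eU U'0) ?(rank_set0 rk') ?re // cE.
  have rU : (0 < rho' U < #|U :\ e|)%N.
    by rewrite (rconnected_rank_gt0 rk' cU' U2) -re rconnected_rank_lt.
  rewrite re in IH1; rewrite minimal_coef_rec //; split; first exact: lerD.
  (* Both summands of the coefficient have their own lower bound, so equality in total makes the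
     deletion sum tight. *)
  move=> E; have /gap2[R [sR cR hR]] : \sum_(A : {set T} | A \proper U :\ e)
      ((rho' (e |: A))%:R - (rho' A)%:R) * beta #|A| (#|U :\ e| - #|A|).-1 =
      (#|U :\ e| - rho' U)%:R^-1 - beta (rho' U) (#|U :\ e| - rho' U).-1.
    by apply/eqP; rewrite eq_le gap1 andbT; move: E IH1; clear; lra.
  exists (U :\: R); split; last exact: (minimal_rank_intro rk' cU' U2 eU).
  rewrite -cR setDDr setDv set0U (setIidPr _) //.
  exact: subset_trans sR (subsetDl _ _).
have /card_gt0P[e eU] : (0 < #|U|)%N by apply: ltnW.
have [U2'|U3] := leqP #|U| 2.
  have cU2 : #|U| = 2 by apply/eqP; rewrite eqn_leq U2' U2.
  have r1 : rho U = 1%N.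
    have := rconnected_rank_gt0 rk cU U2; have := rconnected_rank_lt rk cU U2.
    by rewrite cU2; case: (rho U) => [|[|]].
  have hmin : minimal_rank U (U :\: (U :\ e)) rho.
    apply: (minimal_rank_intro rk cU U2 eU) => [//||f fU /negP//].
    by move: cU2; rewrite r1 (cardsD1 e U) eU => -[].
  have D : U :\: (U :\ e) = [set e].
    by apply/setP=> x; rewrite !inE; case: eqP => [->|_] /=; rewrite ?eU // andNb.
  rewrite D in hmin.
  have cUe : #|U :\ e| = 1%N by move: cU2; rewrite (cardsD1 e U) eU => -[].
  have := lincoef_minimal rk _ _ hmin; rewrite cUe -!card_gt0 cards1 cUe r1 => -> //.
  by split => // _; exists [set e]; rewrite cUe.
case: (rconnected_delete rk cU U2 eU) => cUe; first exact: (step _ e).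
(* Contracting e keeps connectedness here, so the step applies to the dual, and the bound, the
   coefficient and the minimal rank functions are carried back by duality. *)
have rk' := dual_rank_function rk U; have cU' := rconnected_dual rk cU.
have U0 : U != set0 by rewrite -card_gt0 ltnW.
have dU : dual_rank U rho U = (#|U| - rho U)%N.
  by rewrite /dual_rank setDv (rank_set0 rk) addn0.
have [] := step _ e eU rk' cU' cUe U3; rewrite dU.
rewrite minimal_coef_sym; last exact: ltnW (rconnected_rank_lt rk cU U2).
have -> : lincoef U (fun A => (dual_rank U rho A)%:R) = lincoef U (fun A => (rho A)%:R).
  rewrite -(lincoef_dual (g := fun A => (rho A)%:R)) ?(rank_set0 rk) //.
  by apply: eq_lincoef => A _; rewrite -natrD -(dual_rankE rk) natrD addrK.
move=> h1 h2; split=> // /h2[P [cP hP]]; have [sP _] := hP.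
have cPU : (#|P| + #|U :\: P| = #|U|)%N by rewrite -(cardsID P U) (setIidPr sP).
have rlt := rconnected_rank_lt rk cU U2; have rgt := rconnected_rank_gt0 rk cU U2.
have P0 : P != set0 by rewrite -card_gt0; lia.
have [sP' hP'] := minimal_rank_dual rk' P0 hP.
exists (U :\: P); split.
  by rewrite setDDr setDv set0U (setIidPr sP); lia.
by split=> // A sA; rewrite -hP' // dual_rankK.
Qed.
End MinimalRank.

(** * Lattice points of base polytopes *)

Section PolynomialFunctions.
Variable T : finType.
Implicit Types (f : {set T} -> nat) (F : ({set T} -> nat) -> rat).
Implicit Types (G : ({set T} -> nat) -> nat -> rat) (S : {set T}).

(* A weak form of being a polynomial in the values of f: only the restrictions
   to rays matter, with a linear coefficient that is linear in f. *)
Definition ray_poly F := exists (a : rat) (c : {set T} -> rat),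
  forall f, exists P : {poly rat},
    [/\ forall t : nat, F (fun S => t * f S)%N = P.[t%:R], P.[0] = a
      & P^`().[0] = \sum_S c S * (f S)%:R].

Lemma ray_poly_ext F F' : F =1 F' -> ray_poly F -> ray_poly F'.
Proof.
move=> FF [a [c h]]; exists a, c => f; have [P [h1 h2 h3]] := h f.
by exists P; split=> // t; rewrite -FF.
Qed.

Lemma ray_poly_cst a : ray_poly (fun=> a).
Proof.
exists a, (fun=> 0) => f; exists a%:P; split; rewrite ?hornerC //.
  by move=> t; rewrite hornerC.
by rewrite derivC horner0 big1 // => S _; rewrite mul0r.
Qed.

Lemma ray_poly_coord S : ray_poly (fun f => (f S)%:R).
Proof.
exists 0, (fun S' => (S' == S)%:R) => f; exists ((f S)%:R *: 'X); split.
- by move=> t; rewrite hornerZ hornerX natrM mulrC.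
- by rewrite hornerZ hornerX mulr0.
rewrite derivZ derivX hornerZ hornerC mulr1 (bigD1 S) //= eqxx mul1r big1 ?addr0 //.
by move=> S' /negbTE->; rewrite mul0r.
Qed.

Lemma ray_polyD F F' : ray_poly F -> ray_poly F' -> ray_poly (fun f => F f + F' f).
Proof.
move=> [a [c h]] [a' [c' h']]; exists (a + a'), (fun S => c S + c' S) => f.
have [P [h1 h2 h3]] := h f; have [P' [h1' h2' h3']] := h' f.
exists (P + P'); split; rewrite ?hornerD ?h2 ?h2' //.
  by move=> t; rewrite hornerD h1 h1'.
rewrite derivD hornerD h3 h3' -big_split; apply: eq_bigr => S _.
by rewrite mulrDl.
Qed.

Lemma ray_polyM F F' : ray_poly F -> ray_poly F' -> ray_poly (fun f => F f * F' f).
Proof.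
move=> [a [c h]] [a' [c' h']]; exists (a * a'), (fun S => c S * a' + a * c' S) => f.
have [P [h1 h2 h3]] := h f; have [P' [h1' h2' h3']] := h' f.
exists (P * P'); split; rewrite ?hornerM ?h2 ?h2' //.
  by move=> t; rewrite hornerM h1 h1'.
rewrite derivM hornerD !hornerM h3 h3' h2 h2' mulr_suml mulr_sumr -big_split.
by apply: eq_bigr => S _ /=; ring.
Qed.

Lemma ray_poly_ffact S k : ray_poly (fun f => (f S ^_ k)%:R).
Proof.
elim: k => [|k IH]; first exact/ray_poly_ext/(ray_poly_cst 1).
apply: (ray_poly_ext (F := fun f => (f S ^_ k)%:R * ((f S)%:R - k%:R))).
  (* For f S < k the natural and the rational difference disagree, but the other factor is then
     zero. *)
  move=> f; rewrite ffactnSr natrM; have [h|h] := leqP k (f S); first by rewrite natrB.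
  by rewrite ffact_small // !mul0r.
apply: ray_polyM => //; apply: ray_polyD; first exact: ray_poly_coord.
exact: ray_poly_cst.
Qed.

Lemma ray_poly_bin S k : ray_poly (fun f => 'C(f S, k)%:R).
Proof.
apply: (ray_poly_ext (F := fun f => (f S ^_ k)%:R * (k`!%:R)^-1)).
  move=> f; rewrite -bin_ffact natrM mulfK // pnatr_eq0 -lt0n; exact: fact_gt0.
apply: ray_polyM; [exact: ray_poly_ffact | exact: ray_poly_cst].
Qed.

(* Polynomials in an integer variable y whose coefficients, in the binomial
   basis, are polynomial in f. *)
Inductive ray_poly2 : (({set T} -> nat) -> nat -> rat) -> Prop :=
| RayPolyBin F k : ray_poly F -> ray_poly2 (fun f y => F f * 'C(y, k)%:R)
| RayPolyAdd G G' : ray_poly2 G -> ray_poly2 G' ->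
    ray_poly2 (fun f y => G f y + G' f y)
| RayPolyExt G G' : (forall f y, G f y = G' f y) -> ray_poly2 G -> ray_poly2 G'.

Lemma ray_poly2_cst a : ray_poly2 (fun _ _ => a).
Proof.
apply: (RayPolyExt _ (RayPolyBin 0 (ray_poly_cst a))) => f y.
by rewrite bin0 mulr1.
Qed.

Lemma ray_poly2_opp G : ray_poly2 G -> ray_poly2 (fun f y => - G f y).
Proof.
elim=> [F k hF|G1 G2 _ h1 _ h2|G1 G2 E _ h].
- apply: (RayPolyExt _ (RayPolyBin k (ray_polyM (ray_poly_cst (-1)) hF))) => f y.
  by rewrite mulN1r mulNr.
- by apply: (RayPolyExt _ (RayPolyAdd h1 h2)) => f y; rewrite opprD.
- by apply: (RayPolyExt _ h) => f y; rewrite E.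
Qed.

Lemma ray_poly2_diag G S : ray_poly2 G -> ray_poly (fun f => G f (f S)).
Proof.
elim=> [F k hF|G1 G2 _ h1 _ h2|G1 G2 E _ h].
- by apply: ray_polyM => //; apply: ray_poly_bin.
- exact: ray_polyD.
- by apply: (ray_poly_ext _ h) => f; rewrite E.
Qed.

Lemma sum_bin y k : (\sum_(z < y.+1) 'C(z, k) = 'C(y.+1, k.+1))%N.
Proof.
by elim: y => [|y IH]; rewrite big_ord_recr /= ?IH ?big_ord0 //.
Qed.

Lemma ray_poly2_sum G : ray_poly2 G ->
  ray_poly2 (fun f y => \sum_(z < y.+1) G f z).
Proof.
elim=> [F k hF|G1 G2 _ h1 _ h2|G1 G2 E _ h].
- apply: (RayPolyExt _ (RayPolyAdd (RayPolyBin k.+1 hF) (RayPolyBin k hF))) => f y.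
  by rewrite -mulrDr -natrD -mulr_sumr -natr_sum sum_bin binS.
- by apply: (RayPolyExt _ (RayPolyAdd h1 h2)) => f y; rewrite big_split.
- by apply: (RayPolyExt _ h) => f y; apply: eq_bigr => z _; rewrite E.
Qed.

(** A difference of two sums starting at zero; the second is a diagonal value at y = f S, hence a
    coefficient free of y. *)
Lemma ray_poly2_sum_gt G S : ray_poly2 G ->
  exists2 G', ray_poly2 G' & forall f y, (f S <= y)%N ->
    \sum_(z < y.+1 | (f S < z)%N) G f z = G' f y.
Proof.
move=> hG; have hs := ray_poly2_sum hG.
pose G' f (y : nat) := \sum_(z < y.+1) G f z - \sum_(z < (f S).+1) G f z.
exists G'.
  have hd := ray_poly2_opp (RayPolyExt _ (RayPolyBin 0 (ray_poly2_diag S hs))).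
  apply: (RayPolyAdd hs (hd (fun f _ => \sum_(z < (f S).+1) G f z) _)) => f y.
  by rewrite bin0 mulr1.
move=> f y fy; rewrite /G'; have fy' : ((f S).+1 <= y.+1)%N by [].
rewrite (bigID (fun z : 'I_y.+1 => (f S < z)%N) predT) /=.
rewrite (big_ord_widen y.+1 (fun z => G f z)) //.
rewrite [X in _ = _ + X - _](eq_bigl (fun z : 'I_y.+1 => (z < (f S).+1)%N)) ?addrK // => z.
by rewrite -leqNgt.
Qed.

End PolynomialFunctions.

(** * Alternating sums over chains of violated inequalities *)

Section Counting.
Variable T : finType.
Implicit Types (S U D : {set T}) (e : T) (f : {set T} -> nat).

Section Points.
Variable K : nat.
Local Notation point := {ffun T -> 'I_K.+1}.
Implicit Types (x : point) (phi : point -> rat).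

Definition mass x S : nat := (\sum_(i in S) x i)%N.

Definition supported S x := [forall i, (i \notin S) ==> (x i == ord0)].

(* The bound K only makes the set of points finite; every use has y <= K. *)
Definition psum S y phi : rat :=
  \sum_(x | supported S x && (mass x setT == y)) phi x.

Definition depends_on S phi := forall x x', {in S, x =1 x'} -> phi x = phi x'.

Lemma supportedP S x : reflect (forall i, i \notin S -> x i = ord0) (supported S x).
Proof.
apply: (iffP forallP) => h i; first by move=> iS; have := h i; rewrite iS => /eqP.
by apply/implyP => /h->.
Qed.

Lemma massD1 x S e : e \in S -> mass x S = (x e + mass x (S :\ e))%N.
Proof. by move=> eS; rewrite /mass (big_setD1 e). Qed.

Lemma mass_supported x S : supported S x -> mass x setT = mass x S.
Proof.
move=> /supportedP h; rewrite /mass (bigID (fun i => i \in S)) /= addnC big1 ?add0n.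
  by apply: eq_bigl => i; rewrite inE.
by move=> i /andP[_ /h->].
Qed.

Definition set_coord x e (v : 'I_K.+1) : point :=
  [ffun i => if i == e then v else x i].

Lemma mass_set_coord x e v : mass (set_coord x e v) setT = (v + mass (set_coord x e ord0) setT)%N.
Proof.
rewrite !(massD1 _ (in_setT e)) /set_coord !ffunE eqxx add0n; congr (_ + _)%N.
by apply: eq_bigr => i; rewrite !inE !ffunE andbT => /negbTE->.
Qed.

(** As phi ignores coordinate e, the value there is forced to be the slack left by the other
    coordinates; it fits since y <= K. In the proof [c] writes this slack at e and [d] erases it. *)
Lemma psum_add e S y phi : e \notin S -> (y <= K)%N -> depends_on S phi ->
  psum (e |: S) y phi = \sum_(z < y.+1) psum S z phi.
Proof.
move=> eS yK hphi; pose d x := set_coord x e ord0.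
pose c x := set_coord x e (inord (y - mass x setT)).
transitivity (\sum_(x | supported S x && (mass x setT <= y)%N) phi x).
  rewrite /psum (reindex_onto c d) /=; last first.
    move=> x /andP[_ /eqP sx]; apply/ffunP => i; rewrite !ffunE; case: eqP => // ->.
    apply: val_inj; have : mass x setT = (x e + mass (d x) setT)%N.
      rewrite -mass_set_coord; congr mass; apply/ffunP => j; rewrite ffunE.
      by case: eqP => // ->.
    rewrite sx => ->; rewrite addnK inord_val //.
  have E0 x : (d (c x) == x) = (x e == ord0).
    apply/eqP/eqP => [<-|xe]; first by rewrite ffunE eqxx.
    by apply/ffunP => i; rewrite !ffunE; case: eqP => // ->.
  have mc x : x e = ord0 -> mass (c x) setT = ((inord (y - mass x setT) : 'I_K.+1) + mass x setT)%N.
    move=> xe; rewrite mass_set_coord; congr (_ + mass _ _)%N.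
    by apply/ffunP => i; rewrite ffunE; case: eqP => // ->.
  apply: eq_big => [x|x /andP[_]]; last first.
    rewrite E0 => /eqP xe; apply: hphi => i iS; rewrite ffunE; case: eqP => // ie.
    by rewrite -ie iS in eS.
  rewrite E0; apply/andP/andP => [[/andP[/supportedP sx /eqP mx] /eqP xe]|[/supportedP sx mx]].
    split; last by rewrite -mx mc // leq_addl.
    apply/supportedP => i iS; have [->//|ie] := eqVneq i e.
    by have := sx i; rewrite !inE (negbTE ie) iS ffunE (negbTE ie); apply.
  have xe : x e = ord0 by apply: sx.
  split; last by rewrite xe.
  rewrite mc // inordK ?subnK ?eqxx ?andbT //; last by rewrite ltnS (leq_trans (leq_subr _ _)).
  apply/supportedP => i; rewrite !inE negb_or => /andP[/negbTE ie iS].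
  by rewrite ffunE ie sx.
rewrite (partition_big (fun x => inord (mass x setT) : 'I_y.+1) predT) //=.
apply: eq_bigr => z _; apply: eq_bigl => x; rewrite -andbA; congr (_ && _).
have [h|h] := leqP (mass x setT) y => /=; first by rewrite -val_eqE /= inordK.
by apply/esym/negbTE; rewrite neq_ltn (leq_trans (ltn_ord z)) ?orbT.
Qed.

Lemma psum_set0 z phi : psum set0 z phi = if z == 0%N then phi [ffun=> ord0] else 0.
Proof.
have E x : supported set0 x = (x == [ffun=> ord0]).
  apply/supportedP/eqP => [h|->] => [|i _]; last by rewrite ffunE.
  by apply/ffunP => i; rewrite h ?inE // ffunE.
have m0 : mass [ffun=> ord0] setT = 0%N.
  by rewrite /mass big1 // => i _; rewrite ffunE.
rewrite /psum; case: eqP => [->|z0].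
  rewrite (big_pred1 [ffun=> ord0]) // => x; rewrite E /=.
  by case: eqP => // ->; rewrite m0.
by rewrite big_pred0 // => x; rewrite E; case: eqP => //= ->; rewrite m0; case: eqP => // /esym.
Qed.

Lemma psum_one S y : S != set0 -> (y <= K)%N ->
  psum S y (fun=> 1) = 'C(y + #|S|.-1, #|S|.-1)%:R.
Proof.
have [m] := ubnP #|S|; elim: m S y => // m IH S y leS /set0Pn[e eS] yK.
have cS := cardsD1 e S; rewrite eS add1n in cS.
rewrite -(setD1K eS) psum_add // ?setD11 //; rewrite setD1K // cS /=.
have [S0|S0] := eqVneq (S :\ e) set0.
  rewrite S0 cards0 bin0 big_ord_recl psum_set0 eqxx big1 ?addr0 // => i _.
  by rewrite psum_set0.
rewrite (eq_bigr (fun z : 'I_y.+1 => 'C(z + #|S :\ e|.-1, #|S :\ e|.-1)%:R)); last first.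
  move=> z _; apply: IH => //; first by rewrite -ltnS -cS.
  by rewrite (leq_trans _ yK) // -ltnS.
rewrite -natr_sum; congr _%:R; move: S0; rewrite -card_gt0.
case: #|_| => // k _ /=; elim: y {yK} => [|y IHy]; first by rewrite big_ord1 !add0n !binn.
by rewrite big_ord_recr /= IHy [(y.+1 + k)%N]addSnnS [in RHS]addSn binS.
Qed.

Definition bad f x S := (f S < mass x S)%N.

(* chain_sum f x U is the sum of (-1)^m over all chains S_1 < ... < S_m < U of
   bad sets, computed by recursion on S_m. *)
Fixpoint chain_sum_fuel k f x U : rat :=
  if k is k'.+1
  then 1 - \sum_(S : {set T} | (S \proper U) && bad f x S) chain_sum_fuel k' f x S
  else 1.

Definition chain_sum f x U := chain_sum_fuel #|U| f x U.

Lemma chain_sum_fuelE k f x U : (#|U| <= k)%N -> chain_sum_fuel k f x U = chain_sum f x U.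
Proof.
rewrite /chain_sum; have [m] := ubnP #|U|; elim: m U k => // m IH U [|k] leU.
  by rewrite leqn0 => /eqP ->.
move=> leUk /=; case cU : #|U| => [|u] /=.
  rewrite big_pred0 ?subr0 // => S; apply/negbTE/negP => /andP[/proper_card].
  by rewrite cU.
congr (1 - _); apply: eq_bigr => S /andP[/proper_card cS _].
by rewrite !IH //; lia.
Qed.

Lemma chain_sumE f x U : chain_sum f x U =
  1 - \sum_(S : {set T} | (S \proper U) && bad f x S) chain_sum f x S.
Proof.
rewrite -(@chain_sum_fuelE #|U|.+1) //=; congr (1 - _); apply: eq_bigr => S /andP[pS _].
by apply: chain_sum_fuelE; apply/ltnW/proper_card.
Qed.

Lemma mass_ext x x' S : {in S, x =1 x'} -> mass x S = mass x' S.
Proof. by move=> h; apply: eq_bigr => i /h->. Qed.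

Lemma chain_sum_depends f U : depends_on U (fun x => chain_sum f x U).
Proof.
have [m] := ubnP #|U|; elim: m U => // m IH U leU x x' h.
rewrite !chain_sumE; congr (1 - _).
have hS (S : {set T}) : S \proper U -> {in S, x =1 x'}.
  by move=> /proper_sub/subsetP sS i /sS/h.
apply: eq_big => [S|S /andP[pS _]].
  by case pS: (S \proper U) => //=; rewrite /bad (mass_ext (hS S pS)).
by apply: IH; [have := proper_card pS; lia | apply: hS].
Qed.

Lemma sum_chain_sum_below f x U : bad f x U ->
  \sum_(S : {set T} | (S \subset U) && bad f x S) chain_sum f x S = 1.
Proof.
move=> bU; rewrite (bigD1 U) ?subxx //= chain_sumE.
rewrite -[RHS](subrK (\sum_(S : {set T} | (S \proper U) && bad f x S) chain_sum f x S)).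
congr (_ + _); apply: eq_bigl => S; rewrite properEneq.
by rewrite [in RHS]andbC andbA [in RHS]andbC andbA [in RHS]andbC andbC andbA.
Qed.

(* The bad sets are those where f - mass x is negative.  If S0 minimizes this
   submodular function, then S :&: S0 is bad for every bad S, so the order complex
   of the bad sets is contractible: its reduced Euler characteristic vanishes. *)
Lemma chain_sum_indicator f x : f set0 = 0%N ->
  (forall A B, f (A :|: B) + f (A :&: B) <= f A + f B)%N ->
  mass x setT = f setT ->
  chain_sum f x setT = [forall S : {set T}, mass x S <= f S]%N%:R.
Proof.
move=> f0 fsub xT; case: (boolP [forall S, _]) => [/forallP h|].
  rewrite chain_sumE big_pred0 ?subr0 // => S; apply/negbTE/negP => /andP[_].
  by rewrite /bad ltnNge h.
case/forallPn => B; rewrite -ltnNge => hB.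
have [S0 _ minS0] : exists2 S0 : {set T}, true & forall S, (f S0 + mass x S <= f S + mass x S0)%N.
  case: (@arg_minP _ _ _ set0 predT (fun S => ((f S)%:Z - (mass x S)%:Z : int)) isT) => S0 _ hS0.
  by exists S0 => // S; have := hS0 S isT; lia.
have badS0 : bad f x S0 by rewrite /bad; have := minS0 B; lia.
have massUI A C : (mass x (A :|: C) + mass x (A :&: C) = mass x A + mass x C)%N.
  rewrite /mass (big_setID A) /= setUK setDUl setDv set0U -addnA; congr (_ + _)%N.
  by rewrite [RHS](big_setID A) /= setIC addnC.
have badI S : bad f x S -> bad f x (S :&: S0).
  rewrite /bad; have := fsub S S0; have := massUI S S0; have := minS0 (S :|: S0).
  by lia.
(* By induction only the bad sets inside S0 contribute to the recursion at S, that is, the bad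
   subsets of S :&: S0. This set is itself bad, so their contributions add up to 1, and 1 - 1 =
   0. *)
have vanish S : bad f x S -> ~~ (S \subset S0) -> chain_sum f x S = 0.
  have [m] := ubnP #|S|; elim: m S => // m IH S leS bS nS.
  rewrite chain_sumE (bigID (fun S' : {set T} => S' \subset S0)) /=.
  rewrite [X in _ - (_ + X)]big1 ?addr0; last first.
    by move=> S' /andP[/andP[pS' bS'] nS']; apply: IH => //; have := proper_card pS'; lia.
  rewrite (eq_bigl (fun S' : {set T} => (S' \subset S :&: S0) && bad f x S')).
    by rewrite sum_chain_sum_below ?subrr // badI.
  move=> S'; rewrite subsetI andbAC; case: (boolP (S' \subset S0)) => sS'; last by rewrite !andbF.
  rewrite !andbT properEneq; case: eqP => [E|_] //=.
  by rewrite E (negbTE nS) in sS'.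
rewrite chain_sumE (bigID (fun S' : {set T} => S' \subset S0)) /=.
rewrite [X in _ - (_ + X)]big1 ?addr0; last by move=> S /andP[/andP[_ bS] nS]; apply: vanish.
rewrite (eq_bigl (fun S : {set T} => (S \subset S0) && bad f x S)).
  by rewrite sum_chain_sum_below ?subrr.
move=> S; rewrite andbAC; case: (boolP (S \subset S0)) => sS; last by rewrite !andbF.
rewrite !andbT properEneq subsetT andbT; case: eqP => // E.
by rewrite E /bad xT ltnn.
Qed.

End Points.
End Counting.

(** * Polynomiality of the count and its linear coefficient *)

Section CountPolynomial.
Variable T : finType.
Implicit Types (S U D : {set T}) (e : T) (f : {set T} -> nat).

Definition grounded_monotone f :=
  f set0 = 0%N /\ forall A B : {set T}, A \subset B -> (f A <= f B)%N.

(* The count is polynomial only for y >= f U: below, the ranges of summation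
   f S < z <= y become empty without the polynomial vanishing. *)
Definition poly_above U (h : nat -> ({set T} -> nat) -> nat -> rat) :=
  exists2 G, ray_poly2 G & forall f, grounded_monotone f ->
    forall K y, (f U <= y <= K)%N -> h K f y = G f y.

Lemma poly_above_sum U (P : pred {set T}) h :
  (forall S, P S -> poly_above U (h S)) ->
  poly_above U (fun K f y => \sum_(S | P S) h S K f y).
Proof.
move=> hP; suff H (s : seq {set T}) :
    poly_above U (fun K f y => \sum_(S <- s | P S) h S K f y) by apply: H.
elim: s => [|S s [G hG IH]].
  exists (fun _ _ => 0); first exact: ray_poly2_cst.
  by move=> f _ K y _; rewrite big_nil.
case PS: (P S); last first.
  by exists G => // f fm K y hy; rewrite big_cons PS IH.
have [G' hG' h'] := hP S PS; exists (fun f y => G' f y + G f y); first exact: RayPolyAdd.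
by move=> f fm K y hy; rewrite big_cons PS IH // h'.
Qed.

Lemma ray_poly2_bin_add m : ray_poly2 (fun (_ : {set T} -> nat) y => 'C(y + m, m)%:R).
Proof.
elim: m => [|m IH].
  by apply: (RayPolyExt _ (ray_poly2_cst _ 1)) => f y; rewrite bin0.
apply: (RayPolyExt _ (ray_poly2_sum IH)) => f y; rewrite -natr_sum; congr _%:R.
elim: y => [|y IHy]; first by rewrite big_ord1 !add0n !binn.
by rewrite big_ord_recr /= IHy [(y.+1 + m)%N]addSnnS [in RHS]addSn binS.
Qed.

Lemma poly_above_one U : U != set0 -> poly_above U (fun K f y => @psum T K U y (fun=> 1)).
Proof.
move=> U0; exists (fun f y => 'C(y + #|U|.-1, #|U|.-1)%:R); first exact: ray_poly2_bin_add.
by move=> f _ K y /andP[_ yK]; rewrite psum_one.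
Qed.

Lemma psum_bad_small f K S D y : (y <= f S)%N -> S \subset D ->
  @psum T K D y (fun x => (bad f x S)%:R * chain_sum f x S) = 0.
Proof.
move=> yS sSD; rewrite /psum big1 // => x /andP[_ /eqP my].
rewrite /bad ltnNge (leq_trans _ yS) ?mul0r // -my /mass.
rewrite [leqRHS](bigID (fun i => i \in S)) /=; apply: leq_trans (leq_addr _ _).
by rewrite [leqRHS](eq_bigl (fun i => i \in S)) // => i; rewrite inE.
Qed.

(** Splitting off a coordinate outside S gives a sum over the mass z <= y of the others. Terms with
    z <= f S vanish, because S cannot be bad; the rest lie above the threshold. Once only S is left,
    mass z > f S says precisely that S is bad. *)
Lemma poly_above_extend S D :
  poly_above S (fun K f y => @psum T K S y (fun x => chain_sum f x S)) ->
  S \proper D ->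
  poly_above D (fun K f y => @psum T K D y (fun x => (bad f x S)%:R * chain_sum f x S)).
Proof.
move=> [GS hGS hS] pSD.
(* The threshold f S is at most f D and does not depend on D, as the induction on D requires. *)
suff [G hG h] : exists2 G, ray_poly2 G & forall f, grounded_monotone f ->
    forall K y, (f S <= y <= K)%N ->
    @psum T K D y (fun x => (bad f x S)%:R * chain_sum f x S) = G f y.
  exists G => // f fm K y /andP[Dy yK]; apply: h => //.
  by rewrite yK andbT (leq_trans _ Dy) // (fm.2 _ _ (proper_sub pSD)).
have [m] := ubnP #|D|; elim: m D pSD => // m IH D pSD leD.
have [_ [e eD eS]] := properP pSD.
have sS : S \subset D :\ e by rewrite subsetD1 (proper_sub pSD).
have dep f K (E : {set T}) : S \subset E ->
    depends_on E (fun x : {ffun T -> 'I_K.+1} => (bad f x S)%:R * chain_sum f x S).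
  move=> /subsetP sE x x' hx; have hx' : {in S, x =1 x'} by move=> i /sE/hx.
  by rewrite (@chain_sum_depends _ _ f S _ _ hx') /bad (mass_ext hx').
have [G0 hG0 h0] : exists2 G0, ray_poly2 G0 & forall f, grounded_monotone f ->
    forall K y, (f S < y <= K)%N ->
    @psum T K (D :\ e) y (fun x => (bad f x S)%:R * chain_sum f x S) = G0 f y.
  have [ED|nE] := eqVneq S (D :\ e); last first.
    have [||G0 hG0 h0] := IH (D :\ e); first by rewrite properEneq nE.
      by rewrite -ltnS; move: leD; rewrite (cardsD1 e D) eD.
    exists G0 => // f fm K y /andP[Sy yK]; apply: h0 => //.
    by rewrite yK ltnW.
  exists GS => // f fm K y /andP[Sy yK]; rewrite -ED -(hS f fm K); last by rewrite yK ltnW.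
  apply: eq_bigr => x /andP[sx /eqP mx].
  by rewrite /bad -(mass_supported sx) mx Sy mul1r.
have [G hG h] := ray_poly2_sum_gt S hG0.
exists G => // f fm K y /andP[Sy yK].
rewrite -(setD1K eD) psum_add ?setD11 //; last exact: dep.
rewrite -h // [RHS]big_mkcond /=; apply: eq_bigr => z _.
have zy : (z <= y)%N by rewrite -ltnS.
case: ifPn => hz; last by rewrite psum_bad_small // leqNgt.
by rewrite h0 // hz (leq_trans zy yK).
Qed.

Lemma poly_above_chain_sum U : U != set0 ->
  poly_above U (fun K f y => @psum T K U y (fun x => chain_sum f x U)).
Proof.
have [m] := ubnP #|U|; elim: m U => // m IH U leU U0.
have [G1 hG1 h1] := poly_above_one U0.
have [G2 hG2 h2] : poly_above U (fun K f y =>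
    \sum_(S : {set T} | (S \proper U) && (S != set0))
      @psum T K U y (fun x => (bad f x S)%:R * chain_sum f x S)).
  apply: poly_above_sum => S /andP[pS S0]; apply: poly_above_extend => //.
  by apply: IH => //; have := proper_card pS; move: leU; clear; lia.
exists (fun f y => G1 f y + - G2 f y).
  exact/RayPolyAdd/ray_poly2_opp.
move=> f fm K y hy; rewrite -(h1 f fm K) // -(h2 f fm K) //.
rewrite /psum exchange_big -sumrB; apply: eq_bigr => x _ /=.
rewrite chain_sumE; congr (1 - _); rewrite [LHS]big_mkcondr [RHS]big_mkcondr.
(* The empty set, omitted on one side, is never bad because f vanishes there. *)
apply: eq_bigr => S _; case: eqP => [->|_] /=; last by case: ifP; rewrite ?mul1r ?mul0r.
by rewrite /bad fm.1 /mass big_set0.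
Qed.

(** The nonnegative integral points of the base polytope of f. The bound f setT on coordinates loses
    none of them, since it is their total. *)
Definition base_count f := #|[set x : {ffun T -> 'I_(f setT).+1} |
  (mass x setT == f setT) && [forall S : {set T}, mass x S <= f S]%N]|.

Definition submodular f :=
  forall A B, (f (A :|: B) + f (A :&: B) <= f A + f B)%N.

Lemma ray_poly_base_count : [set: T] != set0 ->
  exists2 F, ray_poly F & forall f, grounded_monotone f -> submodular f ->
    (base_count f)%:R = F f.
Proof.
move=> T0; have [G hG h] := poly_above_chain_sum T0.
exists (fun f => G f (f setT)); first exact: ray_poly2_diag.
move=> f fm fs; rewrite -(h f fm (f setT)) ?leqnn // /base_count -sum1_card natr_sum.
rewrite (eq_bigl (fun x : {ffun T -> 'I_(f setT).+1} =>
  (mass x setT == f setT) && [forall S : {set T}, mass x S <= f S]%N)); last first.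
  by move=> x; rewrite inE.
rewrite big_mkcondr /= /psum; apply: eq_big => [x|x /eqP mx].
  by have -> : supported setT x by apply/supportedP => i; rewrite inE.
by rewrite (chain_sum_indicator fm.1 fs mx); case: ifP.
Qed.

Definition dilate (t : nat) f S := (t * f S)%N.

Lemma dilate_grounded t f : grounded_monotone f -> grounded_monotone (dilate t f).
Proof.
by move=> [f0 fm]; split=> [|A B /fm h]; rewrite /dilate ?f0 ?muln0 // leq_mul2l h orbT.
Qed.

Lemma dilate_submodular t f : submodular f -> submodular (dilate t f).
Proof. by move=> fs A B; rewrite /dilate -!mulnDr leq_mul2l fs orbT. Qed.

Lemma poly_eq_on_nat (P Q : {poly rat}) :
  (forall t : nat, P.[t%:R] = Q.[t%:R]) -> P = Q.
Proof.
move=> PQ; apply/eqP; rewrite -subr_eq0; apply/negPn/negP => pq0.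
pose s : seq rat := [seq k%:R | k <- iota 0 (size (P - Q))].
have us : uniq s by rewrite map_inj_uniq ?iota_uniq //; exact: (mulrIn (oner_neq0 _)).
have rs : all (root (P - Q)) s.
  by apply/allP => _ /mapP[k _ ->]; rewrite rootE hornerD hornerN PQ subrr.
by have := max_poly_roots pq0 rs us; rewrite size_map size_iota ltnn.
Qed.

Lemma base_count_linear : [set: T] != set0 ->
  exists c : {set T} -> rat, forall f (P : {poly rat}),
    grounded_monotone f -> submodular f ->
    (forall t : nat, (base_count (dilate t f))%:R = P.[t%:R]) ->
    P^`().[0] = \sum_S c S * (f S)%:R.
Proof.
move=> T0; have [F [a [c hF]] h] := ray_poly_base_count T0.
exists c => f P fm fs hP; have [Q [h1 _ <-]] := hF f.
have -> // : P = Q; apply: poly_eq_on_nat => t.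
by rewrite -hP -h1 h //; [exact: dilate_grounded | exact: dilate_submodular].
Qed.

Definition meets (I : {set T}) S : nat := (S :&: I != set0).

Lemma meets_grounded I : grounded_monotone (meets I).
Proof.
split=> [|A B sAB]; rewrite /meets ?set0I ?eqxx //.
case: (boolP (A :&: I != set0)) => // /set0Pn[x]; rewrite inE => /andP[xA xI].
by have -> // : B :&: I != set0; apply/set0Pn; exists x; rewrite inE (subsetP sAB).
Qed.

Lemma meets_submodular I : submodular (meets I).
Proof.
move=> A B; rewrite /meets setIUl setU_eq0 negb_and.
have : (A :&: B) :&: I != set0 -> (A :&: I != set0) && (B :&: I != set0).
  case/set0Pn => x; rewrite !inE => /andP[/andP[xA xB] xI].
  by apply/andP; split; apply/set0Pn; exists x; rewrite inE ?xA ?xB.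
by case: (_ == set0); case: (A :&: I == set0); case: (B :&: I == set0) => // /(_ isT).
Qed.

Lemma base_count_meets I t : I != set0 ->
  base_count (dilate t (meets I)) = 'C(t + #|I|.-1, #|I|.-1).
Proof.
move=> I0; have mT : dilate t (meets I) setT = t by rewrite /dilate /meets setTI I0 muln1.
apply/eqP; rewrite -(eqr_nat rat); apply/eqP.
rewrite -[in RHS]mT -(@psum_one T (dilate t (meets I) setT)) //.
rewrite /base_count -sum1_card natr_sum /psum; apply: eq_bigl => x.
rewrite inE andbC; apply: andb_id2r => /eqP mx; apply/forallP/supportedP => [h i iI|/supportedP h S].
  have := h [set i]; rewrite /mass big_set1 /dilate /meets.
  have -> : [set i] :&: I = set0.
    by apply/setP=> j; rewrite !inE; case: eqP => // ->; rewrite (negbTE iI).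
  by rewrite eqxx muln0 leqn0 => /eqP xi; apply: val_inj.
have [S0|S0] := eqVneq (S :&: I) set0; rewrite /dilate /meets.
  rewrite S0 eqxx muln0 leqn0 /mass big1 // => i iS.
  have -> // : x i = ord0; apply: (supportedP _ _ h); apply/negP => iI.
  by move/setP: S0 => /(_ i); rewrite !inE iS iI.
rewrite S0 muln1; apply: (@leq_trans (mass x setT)); last by rewrite mx mT.
rewrite /mass [leqRHS](bigID (fun i => i \in S)) /=.
by rewrite [X in (_ <= X + _)%N](eq_bigl (fun i => i \in S)) ?leq_addr // => i; rewrite inE.
Qed.

(** The binomial coefficient is the product of 1 + t/i for i = 1, ..., m, whose linear coefficient
    is the sum of the 1/i. *)
Lemma binomial_poly m : exists2 P : {poly rat},
  forall t : nat, 'C(t + m, m)%:R = P.[t%:R] & P.[0] = 1 /\ P^`().[0] = harmonic_number m.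
Proof.
elim: m => [|m [P hP [P0 P1]]].
  exists 1; first by move=> t; rewrite bin0 hornerC.
  by rewrite hornerC derivC horner0 harmonic0.
exists (P * ((m.+1%:R)^-1 *: 'X + 1)).
  move=> t; rewrite hornerM -hP hornerD hornerZ hornerX hornerC.
  have h := mul_bin_diag (t + m).+1 m; rewrite addnS; rewrite /= in h.
  have m0 : m.+1%:R != 0 :> rat by rewrite pnatr_eq0.
  apply: (mulfI m0); rewrite -natrM -h natrM -addnS natrD [RHS]mulrCA mulrDr mulr1 mulrA mulfV // mul1r mulrC //.
rewrite hornerM derivM !(hornerD, hornerM, hornerZ, hornerX, hornerC, derivD, derivZ, derivX, derivC).
by rewrite P0 P1 harmonicS; split; ring.
Qed.

Theorem base_count_deriv f (P : {poly rat}) : [set: T] != set0 ->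
  grounded_monotone f -> submodular f ->
  (forall t : nat, (base_count (dilate t f))%:R = P.[t%:R]) ->
  P^`().[0] = lincoef setT (fun S => (f S)%:R).
Proof.
move=> T0 fm fs hP; have [c hc] := base_count_linear T0.
rewrite (hc _ _ fm fs hP).
pose w S : rat := if S == setT then - harmonic_number #|[set: T]|.-1
  else if S != set0 then beta #|S|.-1 (#|[set: T]| - #|S|).-1 else 0.
have linE (g : {set T} -> rat) : lincoef setT g = \sum_S w S * g S.
  rewrite (bigD1 setT) //= {1}/w eqxx addrC /lincoef mulNr [g _ * _]mulrC; congr (_ - _).
  rewrite big_mkcond [RHS]big_mkcond; apply: eq_bigr => S _.
  rewrite properEneq subsetT andbT /w; case: eqP => //= _.
  by case: ifP; rewrite ?mul0r // mulrC.
rewrite linE; pose d S := c S - w S.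
have dI (I : {set T}) : I != set0 -> \sum_S d S * (meets I S)%:R = 0.
  move=> I0; have [Q hQ [_ Q1]] := binomial_poly #|I|.-1.
  have hQ' : Q^`().[0] = \sum_S c S * (meets I S)%:R.
    apply: hc => [||t]; [exact: meets_grounded | exact: meets_submodular |].
    by rewrite base_count_meets // hQ.
  have := lincoef_simplex (subsetT I) I0; rewrite linE -Q1 hQ' => h.
  rewrite (eq_bigr (fun S => c S * (meets I S)%:R - w S * (S :&: I != set0)%:R)).
    by rewrite sumrB h subrr.
  by move=> S _; rewrite mulrBl.
(* A nonempty set either lies in J or meets its complement, so [dI] for setT minus [dI] for ~: J
   isolates the nonempty subsets of J. Induction on the size of S then gives d S = 0. *)
have dsub (J : {set T}) : \sum_(S : {set T} | (S \subset J) && (S != set0)) d S = 0.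
  have total : \sum_(S : {set T} | S != set0) d S = 0.
    rewrite -[RHS](dI _ T0) big_mkcond; apply: eq_bigr => S _; rewrite /meets setIT.
    by case: (S != set0); rewrite ?mulr1 ?mulr0.
  have [->|JT] := eqVneq J setT.
    by rewrite -[RHS]total; apply: eq_bigl => S; rewrite subsetT.
  have CJ0 : ~: J != set0.
    by apply: contraNneq JT => E; rewrite -(setCK J) E setC0.
  move: total; rewrite (bigID (fun S : {set T} => S \subset J)) /=.
  have -> : \sum_(S : {set T} | (S != set0) && ~~ (S \subset J)) d S = 0.
    rewrite -[RHS](dI _ CJ0) big_mkcond; apply: eq_bigr => S _.
    rewrite /meets -setDE setD_eq0; case: (boolP (S \subset J)) => sS /=.
      by rewrite andbF mulr0.
    by rewrite andbT mulr1; case: eqP sS => // ->; rewrite sub0set.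
  by rewrite addr0 => E; rewrite -[RHS]E; apply: eq_bigl => S; rewrite andbC.
have d0 S : S != set0 -> d S = 0.
  have [m] := ubnP #|S|; elim: m S => // m IH S leS S0.
  have := dsub S; rewrite (bigD1 S) ?subxx //= big1 ?addr0 // => S' /andP[/andP[sS S'0] nS].
  apply: IH => //; have : S' \proper S by rewrite properEneq nS.
  by move/proper_card; move: leS; clear; lia.
apply: eq_bigr => S _; have [->|S0] := eqVneq S set0; first by rewrite fm.1 !mulr0.
by rewrite -[c S](subrK (w S)) -/(d S) d0 // add0r.
Qed.

End CountPolynomial.

(** * Matroids and their polytopes *)

Section Sandwich.
Variable T : finType.
Implicit Types (U A B : {set T}) (e : T) (f g : {set T} -> int).

Lemma setU1D1 e A B : (e |: A) :|: (B :\ e) = e |: (A :|: B) /\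
  (e |: A) :&: (B :\ e) = (A :&: B) :\ e.
Proof.
by split; apply/setP=> x; rewrite !inE; case: (x == e); case: (x \in A); case: (x \in B).
Qed.

(** Frank's discrete sandwich theorem. The value at one element e is fixed, then f and g are
    replaced by the tightest bounds this leaves on the other elements; in the induction U holds the
    elements not yet fixed. *)
Lemma discrete_sandwich f g : f set0 = 0 -> g set0 = 0 ->
  (forall A B, f (A :|: B) + f (A :&: B) <= f A + f B) ->
  (forall A B, g A + g B <= g (A :|: B) + g (A :&: B)) ->
  (forall A, g A <= f A) ->
  exists z : T -> int, forall A, g A <= \sum_(i in A) z i <= f A.
Proof.
suff H U : forall f g, f set0 = 0 -> g set0 = 0 ->
    (forall A B, f (A :|: B) + f (A :&: B) <= f A + f B) ->
    (forall A B, g A + g B <= g (A :|: B) + g (A :&: B)) ->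
    (forall A, g A <= f A) -> (forall A, f A = f (A :&: U)) -> (forall A, g A = g (A :&: U)) ->
    exists z : T -> int, forall A, g A <= \sum_(i in A) z i <= f A.
  by move=> *; apply: (H setT) => // A; rewrite setIT.
clear f g; have [m] := ubnP #|U|; elim: m U => // m IH U leU f g f0 g0 fsub gsup gf fU gU.
have [U0|[e eU]] := set_0Vmem U.
  exists (fun=> 0) => A; rewrite fU gU U0 setI0 f0 g0 big1 //.
(* The largest of the lower bounds on the value at e. By [hi], where submodularity, supermodularity
   and g <= f combine, it respects all the upper bounds. *)
pose z0 := g (e |: [arg max_(A > set0) (g (e |: A) - f (A :\ e))]%O) -
  f ([arg max_(A > set0) (g (e |: A) - f (A :\ e))]%O :\ e).
have lo A : g (e |: A) - f (A :\ e) <= z0.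
  by rewrite /z0; case: arg_maxP => //= A0 _; apply.
have hi A : z0 <= f (e |: A) - g (A :\ e).
  rewrite /z0; case: arg_maxP => //= A0 _ _.
  have [e1 e2] := setU1D1 e A A0; have [e3 e4] := setU1D1 e A0 A.
  have := fsub (e |: A) (A0 :\ e); have := gsup (e |: A0) (A :\ e).
  rewrite e1 e2 e3 e4 [A0 :|: A]setUC [A0 :&: A]setIC.
  have := gf (e |: (A :|: A0)); have := gf ((A :&: A0) :\ e); lia.
(* A set without e is bounded directly, and also through its union with e, where e takes the value
   z0. *)
pose f' A := Num.min (f (A :\ e)) (f (e |: A) - z0).
pose g' A := Num.max (g (A :\ e)) (g (e |: A) - z0).
have UU A B : (A :|: B) :\ e = (A :\ e) :|: (B :\ e) by rewrite setDUl.
have II A B : (A :&: B) :\ e = (A :\ e) :&: (B :\ e) by rewrite setDIl.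
have Ue A B : e |: (A :|: B) = (e |: A) :|: (e |: B) by rewrite setUUr.
have Ie A B : e |: (A :&: B) = (e |: A) :&: (e |: B) by rewrite setUIr.
have F0 : f' set0 = 0 by have := hi set0; rewrite /f' set0D f0 g0; lia.
have G0 : g' set0 = 0 by have := lo set0; rewrite /g' set0D f0 g0; lia.
have Fs A B : f' (A :|: B) + f' (A :&: B) <= f' A + f' B.
  have := fsub (A :\ e) (B :\ e); have := fsub (e |: A) (e |: B).
  have := fsub (e |: A) (B :\ e); have := fsub (e |: B) (A :\ e).
  rewrite -UU -II -Ue -Ie; have [-> ->] := setU1D1 e A B; have [-> ->] := setU1D1 e B A.
  by rewrite [B :|: A]setUC [B :&: A]setIC /f'; clear; lia.
have Gs A B : g' A + g' B <= g' (A :|: B) + g' (A :&: B).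
  have := gsup (A :\ e) (B :\ e); have := gsup (e |: A) (e |: B).
  have := gsup (e |: A) (B :\ e); have := gsup (e |: B) (A :\ e).
  rewrite -UU -II -Ue -Ie; have [-> ->] := setU1D1 e A B; have [-> ->] := setU1D1 e B A.
  by rewrite [B :|: A]setUC [B :&: A]setIC /g'; clear; lia.
have FG A : g' A <= f' A.
  have := lo A; have := hi A; have := gf (A :\ e); have := gf (e |: A).
  by rewrite /f' /g'; clear; lia.
have D A : ((A :&: (U :\ e)) :\ e) :&: U = (A :\ e) :&: U.
  by apply/setP=> x; rewrite !inE; case: (x == e); case: (x \in A); case: (x \in U).
have E A : (e |: (A :&: (U :\ e))) :&: U = (e |: A) :&: U.
  by apply/setP=> x; rewrite !inE; case: (x == e); case: (x \in A); case: (x \in U).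
have FU A : f' A = f' (A :&: (U :\ e)).
  by rewrite /f' [in RHS]fU D -fU (fU (e |: A :&: _)) E -fU.
have GU A : g' A = g' (A :&: (U :\ e)).
  by rewrite /g' [in RHS]gU D -gU (gU (e |: A :&: _)) E -gU.
have leU' : (#|U :\ e| < m)%N by move: leU; rewrite (cardsD1 e U) eU.
have [z hz] := IH _ leU' f' g' F0 G0 Fs Gs FG FU GU.
have hz' A : g (A :\ e) <= \sum_(i in A :\ e) z i <= f (A :\ e) /\
    g (e |: A) - z0 <= \sum_(i in A :\ e) z i <= f (e |: A) - z0.
  have := hz (A :\ e); rewrite /f' /g' setDDl setUid; have -> : e |: (A :\ e) = e |: A.
    by apply/setP=> x; rewrite !inE; case: (x == e).
  by rewrite ge_max le_min => /andP[/andP[-> ->] /andP[-> ->]].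
exists (fun i => if i == e then z0 else z i) => A; have [h1 h2] := hz' A.
have zD : \sum_(i in A :\ e) (if i == e then z0 else z i) = \sum_(i in A :\ e) z i.
  by apply: eq_bigr => i; rewrite !inE => /andP[/negbTE->].
have [eA|eA] := boolP (e \in A).
  rewrite (big_setD1 e) //= eqxx zD; move: h2; rewrite (setUidPr _) ?sub1set //.
  by clear; lia.
have AD : A :\ e = A by apply/setDidPl; rewrite disjoint_sym disjoints1.
by rewrite -AD zD.
Qed.
End Sandwich.

(** * The rank function of a matroid *)

Section MatroidRank.
Variables (T : finType) (M : matroid T).
Implicit Types (A B X Y Z : {set T}).

Local Open Scope nat_scope.

Definition mrank A := \max_(B in bases M) #|A :&: B|.

Lemma exchange_card A x y : x \in A -> y \notin A -> #|y |: (A :\ x)| = #|A|.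
Proof.
by move=> xA yA; rewrite cardsU1 !inE negb_and yA orbT (cardsD1 x A) xA.
Qed.

Lemma exchange_closer A B x y : x \in A -> x \notin B -> y \in B -> y \notin A ->
  #|(y |: (A :\ x)) :\: B| < #|A :\: B|.
Proof.
move=> xA xB yB yA; apply: proper_card; apply/properP; split; last first.
  exists x; rewrite !inE ?xA ?xB //= eqxx /= orbF.
  by apply: contraNneq yA => <-.
apply/subsetP => z; rewrite !inE => /andP[zB /orP[/eqP zy|/andP[_ ->]]]; last by rewrite zB.
by rewrite zy yB in zB.
Qed.

Lemma bases_card A B : A \in bases M -> B \in bases M -> #|A| = #|B|.
Proof.
have [m] := ubnP #|A :\: B|; elim: m A => // m IH A leA hA hB.
have [/eqP|[x]] := set_0Vmem (A :\: B).
  rewrite setD_eq0 => sAB; suff -> : A = B by [].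
  apply/eqP; rewrite eqEsubset sAB; apply/subsetP => y yB; apply/negPn/negP => yA.
  have [z [zA zB _]] := bases_exchange hB hA yB yA.
  by rewrite (subsetP sAB _ zA) in zB.
rewrite inE => /andP[xB xA]; have [y [yB yA hy]] := bases_exchange hA hB xA xB.
rewrite -(exchange_card xA yA); apply: IH => //.
by rewrite -ltnS; apply: leq_trans leA; rewrite ltnS; apply: exchange_closer.
Qed.

Lemma mrankP A : exists2 B, B \in bases M & #|A :&: B| = mrank A.
Proof.
have b0 : 0 < #|bases M| by rewrite card_gt0 bases_neq0.
by have [B hB e] := eq_bigmax_cond (fun B => #|A :&: B|) b0; exists B.
Qed.

Lemma mrank_ge A B : B \in bases M -> #|A :&: B| <= mrank A.
Proof. by move=> hB; apply: (leq_bigmax_cond (F := fun B => #|A :&: B|)). Qed.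

(** Among the bases optimal for X take A with the largest trace on Z, and move it towards a basis C
    optimal for Z. Exchanging out an element outside Z lowers neither trace. Once A - C lies in Z, A
    has no more elements outside Z than C, so its trace on Z is as large. *)
Lemma mrank_chain X Z : X \subset Z ->
  exists B, [/\ B \in bases M, #|X :&: B| = mrank X & #|Z :&: B| = mrank Z].
Proof.
move=> sXZ; have [B1 hB1 oB1] := mrankP X.
pose P B := (B \in bases M) && (#|X :&: B| == mrank X).
have P1 : P B1 by rewrite /P hB1 oB1 eqxx.
case: (arg_maxnP (fun B : {set T} => #|Z :&: B|) P1) => A /andP[hA /eqP oA] maxA.
have [C hC oC] := mrankP Z.
suff : mrank Z <= #|Z :&: A|.
  by exists A; split=> //; apply/eqP; rewrite eqn_leq mrank_ge.
have [m] := ubnP #|A :\: C|; elim: m A hA oA maxA => // m IH A hA oA maxA leA.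
have [sAC|/subsetPn[x]] := boolP (A :\: C \subset Z).
  rewrite -oC; have cA := cardsID Z A; have cC := cardsID Z C.
  have := bases_card hA hC; rewrite ![Z :&: _]setIC.
  have : #|A :\: Z| <= #|C :\: Z|.
    apply: subset_leq_card; apply/subsetP => x; rewrite !inE => /andP[xZ xA].
    by rewrite xZ; apply/negPn/negP => xC; move: (subsetP sAC x) xZ; rewrite !inE xC xA => /(_ isT)->.
  by lia.
rewrite inE => /andP[xC xA] xZ; have [y [yC yA hy]] := bases_exchange hA hC xA xC.
have sub Y : Y \subset Z -> Y :&: A \subset Y :&: (y |: A :\ x).
  move=> sY; apply/subsetP => z; rewrite !inE => /andP[zY zA]; rewrite zY zA andbT /=.
  by apply/orP; right; apply: contraNneq xZ => <-; apply: (subsetP sY).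
have oy : #|X :&: (y |: A :\ x)| = mrank X.
  by apply/eqP; rewrite eqn_leq mrank_ge // -oA subset_leq_card // sub.
have leZ := subset_leq_card (sub Z (subxx _)).
have geZ : #|Z :&: (y |: A :\ x)| <= #|Z :&: A| by apply: maxA; rewrite /P hy oy eqxx.
have eZ : #|Z :&: (y |: A :\ x)| = #|Z :&: A| by apply/eqP; rewrite eqn_leq geZ.
rewrite -eZ; apply: IH => // [B hB|].
  by rewrite eZ; apply: maxA.
by rewrite -ltnS; apply: leq_trans leA; rewrite ltnS; apply: exchange_closer.
Qed.

Lemma mrank_function : rank_function mrank.
Proof.
split=> [A|A B sAB|A B].
- by apply/bigmax_leqP => B _; rewrite subset_leq_card // subsetIl.
- apply/bigmax_leqP => C hC; apply: leq_trans (mrank_ge B hC).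
  by rewrite subset_leq_card // setSI.
(* With one basis C optimal for both the intersection and the union, submodularity follows from the
   modularity of the size of the trace on C. *)
have [C [hC <- <-]] := mrank_chain (subset_trans (subsetIl A B) (subsetUl A B)).
apply: (@leq_trans (#|A :&: C| + #|B :&: C|)); last by rewrite leq_add ?mrank_ge.
by rewrite setIUl setIIl cardsUI.
Qed.

Lemma mrankT : mrank setT = rank M.
Proof. by apply: eq_bigr => B _; rewrite setTI. Qed.

Lemma card_basis B : B \in bases M -> #|B| = rank M.
Proof.
move=> hB; rewrite -mrankT; have [C hC <-] := mrankP setT.
by rewrite setTI; apply: bases_card.
Qed.

Lemma basis_mrank B : (B \in bases M) = (#|B| == rank M) && (mrank B == rank M).
Proof.
apply/idP/andP => [hB|[/eqP cB /eqP rB]].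
  rewrite card_basis // eqxx; split=> //; rewrite eqn_leq -{1}(card_basis hB).
  by have [le _ _] := mrank_function; rewrite le -{1}(card_basis hB) -{1}(setIid B) mrank_ge.
have [C hC] := mrankP B; rewrite rB => cI.
suff -> : B = C by [].
have sBC : B \subset C.
  by rewrite -(setIidPl (_ : B \subset C)); [exact: subsetIr | apply/setIidPl/eqP; rewrite eqEcard subsetIl cI cB /=].
by apply/eqP; rewrite eqEcard sBC cB (card_basis hC) /=.
Qed.

Lemma indep_mrank A : indep M A = (mrank A == #|A|).
Proof.
apply/exists_inP/eqP => [[B hB sA]|rA].
  apply/eqP; rewrite eqn_leq; have [-> _ _] := mrank_function.
  by rewrite -{1}(setIidPl sA) mrank_ge.
have [B hB cB] := mrankP A; exists B => //.
by apply/setIidPl/eqP; rewrite eqEcard subsetIl cB rA /=.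
Qed.

(* No circuit C meets both sides of a separator A: the proper subsets C :&: A and
   C :\: A of C would be independent, with ranks adding up to that of C. *)
Lemma connected_rconnected : connected M -> rconnected setT mrank.
Proof.
move=> conn; apply/rconnectedP => A /set0Pn[x xA] /properP[_ [y _ yA]].
have xy : x != y by apply: contraNneq yA => <-.
have [C [/minsetP[nC minC] xC yC]] := conn x y xy.
have rk := mrank_function; have [le mono sub] := rk.
have ind (D : {set T}) : D \proper C -> mrank D = #|D|.
  move=> pD; apply/eqP; rewrite -indep_mrank; apply: contraT => nD.
  have eD : D = C by apply: minC; [exact: nD | exact: proper_sub].
  by move: pD; rewrite eD properxx.
have rC : mrank C < #|C|.
  by rewrite ltn_neqAle le andbT -indep_mrank; exact: nC.
have rCA : mrank (C :&: A) = #|C :&: A|.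
  apply: ind; apply/properP; split; first exact: subsetIl.
  by exists y; rewrite // inE (negbTE yA) andbF.
have rCD : mrank (C :\: A) = #|C :\: A|.
  apply: ind; apply/properP; split; first exact: subsetDl.
  by exists x; rewrite // inE xA.
have := cardsID A C.
have := sub C A; have := sub (C :|: A) (setT :\: A); rewrite setTD.
have -> : C :|: A :|: ~: A = setT by rewrite -setUA setUCr setUT.
have -> : (C :|: A) :&: ~: A = C :\: A by rewrite setIUl setICr setU0 setDE.
by move: rC rCA rCD; clear; lia.
Qed.

End MatroidRank.

(** * Bases and ranks of the minimal matroid *)

Section MinimalMatroid.

Local Open Scope nat_scope.

Lemma card_sum_set (S1 S2 : finType) (B : {set S1 + S2}) :
  #|B| = #|[set x | inl x \in B]| + #|[set x | inr x \in B]|.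
Proof.
rewrite -!sum1_card big_mkcond big_sumType /= -!big_mkcond /=.
by congr (_ + _); apply: eq_bigl => x; rewrite inE.
Qed.

Lemma card_sub_set (S : finType) (p : S) (B : {set S}) :
  #|B| = (p \in B) + #|[set x : {x : S | x != p} | val x \in B]|.
Proof.
rewrite (cardsD1 p B); congr (_ + _).
rewrite -(card_imset _ val_inj); apply: eq_card => x; rewrite !inE.
apply/andP/imsetP => [[xp xB]|[y]].
  by exists (Sub x xp); rewrite ?inE ?SubK.
by rewrite inE => yB ->; split; first exact: (valP y).
Qed.

Lemma minimal_basesE r n (B : {set {x : 'I_r.+1 | x != ord0} + {x : 'I_(n - r).+1 | x != ord0}}) :
  (B \in bases (minimal_matroid r n)) =
  (#|B| == r) && (#|[set x | inr x \in B]| <= 1).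
Proof.
have glueE (B1 : {set 'I_r.+1}) (B2 : {set 'I_(n - r).+1}) :
    ([set x | inl x \in glue ord0 ord0 B1 B2] = [set x | val x \in B1]) *
    ([set x | inr x \in glue ord0 ord0 B1 B2] = [set x | val x \in B2]).
  by split; apply/setP=> x; rewrite !inE.
apply/two_sum_basesP/andP => [[B1 [B2 []]]|[/eqP cB cR]].
  rewrite !inE (minn_idPl (leqnSn r)) (minn_idPl (ltn0Sn _)).
  rewrite [#|B1|](card_sub_set ord0) [#|B2|](card_sub_set ord0).
  move=> /eqP h1 /eqP h2 hx ->; rewrite card_sum_set !glueE.
  move: hx h1 h2; move: #|[set x : {x : 'I_r.+1 | x != ord0} | val x \in B1]| => a.
  move: #|[set x : {x : 'I_(n - r).+1 | x != ord0} | val x \in B2]| => b.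
  by case: (_ \in B1); case: (_ \in B2) => //= _; lia.
(* If B uses the parallel class, the basepoint lies in B1, which then omits one element of the left
   side. Otherwise B1 omits the basepoint and B2 consists of it alone. *)
pose hasR := [set x | inr x \in B] != set0.
pose B1 : {set 'I_r.+1} :=
  [set i | if insub i is Some x then inl x \in B else hasR].
pose B2 : {set 'I_(n - r).+1} :=
  [set i | if insub i is Some x then inr x \in B else ~~ hasR].
have v1 : [set x : {x : 'I_r.+1 | x != ord0} | val x \in B1] = [set x | inl x \in B].
  by apply/setP => x; rewrite !inE valK.
have v2 : [set x : {x : 'I_(n - r).+1 | x != ord0} | val x \in B2] = [set x | inr x \in B].
  by apply/setP => x; rewrite !inE valK.
have p1 : (ord0 \in B1) = hasR by rewrite inE insubF ?eqxx.
have p2 : (ord0 \in B2) = ~~ hasR by rewrite inE insubF ?eqxx.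
have cR' : #|[set x | inr x \in B]| = hasR.
  by move: cR; rewrite /hasR -card_gt0; case: #|_| => [|[|]].
rewrite card_sum_set cR' in cB.
exists B1, B2; split.
- by rewrite inE (minn_idPl (leqnSn r)) (card_sub_set ord0) v1 p1 -[X in _ == X]cB addnC.
- by rewrite inE (minn_idPl (ltn0Sn _)) (card_sub_set ord0) v2 p2 cR'; case: (hasR).
- by rewrite p1 p2; case: (hasR).
by apply/setP => -[x|x]; rewrite !inE valK.
Qed.

Lemma inj_of_card (T S : finType) (A : {set T}) (s0 : S) : #|A| <= #|S| ->
  exists g : T -> S, {in A &, injective g}.
Proof.
move=> AS; exists (fun x => nth s0 (enum S) (index x (enum A))) => x y xA yA.
have idx z : z \in A -> index z (enum A) < size (enum S).
  by move=> zA; rewrite -cardE (leq_trans _ AS) // cardE index_mem mem_enum.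
move=> /eqP; rewrite nth_uniq ?idx ?enum_uniq // => /eqP E.
have := congr1 (nth x (enum A)) E.
by rewrite !nth_index ?mem_enum.
Qed.

Variables (n r : nat) (M : matroid 'I_n).
Hypotheses (rM : rank M = r) (r0 : 0 < r) (rn : r < n).

Lemma isomorphic_minimalP :
  isomorphic M (minimal_matroid r n) <->
  exists P : {set 'I_n}, #|~: P| = r /\
    forall B, (B \in bases M) = (#|B| == r) && (#|B :&: P| <= 1).
Proof.
have cs m : #|[set: {x : 'I_m.+1 | x != ord0}]| = m.
  by rewrite cardsT card_sig -[RHS]/(m.+1.-1) -[in RHS](card_ord m.+1) -(cardC1 ord0).
split=> [[f bf hf]|[P [cP hP]]].
  pose P := [set x | if f x is inr _ then true else false].
  have inr_im (B : {set 'I_n}) : #|[set x | inr x \in f @: B]| = #|B :&: P|.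
    rewrite -(card_imset _ (bij_inj bf)) -[LHS](card_imset _ (inr_inj (A := {x : 'I_r.+1 | x != ord0}))).
    apply: eq_card => u; apply/imsetP/imsetP => [[x]|[x]].
      by rewrite inE => /imsetP[i iB ex] ->; exists i; rewrite // !inE iB -ex.
    rewrite !inE => /andP[xB]; case fx : (f x) => [//|y] _ ->.
    by exists y; rewrite // inE; apply/imsetP; exists x.
  exists P; split.
    have := cardsC P; rewrite card_ord.
    have -> : #|P| = n - r.
      rewrite -(setTI P) -inr_im -[RHS]cs; apply: eq_card => x; rewrite !inE.
      have [g _ fg] := bf; apply/imsetP; exists (g (inr x)); rewrite ?inE //.
    lia.
  by move=> B; rewrite hf minimal_basesE card_imset ?inr_im //; exact: bij_inj.
have s1 : 0 < #|{: {x : 'I_r.+1 | x != ord0}}| by rewrite -cardsT cs.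
have s2 : 0 < #|{: {x : 'I_(n - r).+1 | x != ord0}}| by rewrite -cardsT cs subn_gt0.
have cP' : #|P| = n - r by have := cardsC P; rewrite card_ord; lia.
have [/= x1 _] := card_gt0P s1; have [/= x2 _] := card_gt0P s2.
have [|g1 i1] := inj_of_card (A := ~: P) x1; first by rewrite cP -cardsT cs.
have [|g2 i2] := inj_of_card (A := P) x2; first by rewrite cP' -cardsT cs.
pose f x : {x : 'I_r.+1 | x != ord0} + {x : 'I_(n - r).+1 | x != ord0} :=
  if x \in P then inr (g2 x) else inl (g1 x).
have fi : injective f.
  move=> x y; rewrite /f; case: ifPn => xP; case: ifPn => yP // [].
    by apply: i2.
  by apply: i1; rewrite inE.
have inr_im (B : {set 'I_n}) : #|[set x | inr x \in f @: B]| = #|B :&: P|.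
  rewrite -(card_imset _ fi) -[LHS](card_imset _ (inr_inj (A := {x : 'I_r.+1 | x != ord0}))).
  apply: eq_card => u; apply/imsetP/imsetP => [[x]|[x]].
    rewrite inE => /imsetP[i iB ex] ->; exists i; rewrite // inE iB /=.
    by move: ex; rewrite /f; case: ifP.
  rewrite !inE => /andP[xB xP] ->; exists (g2 x); rewrite /f ?xP // inE.
  by apply/imsetP; exists x; rewrite // /f xP.
exists f.
  apply: inj_card_bij => //; rewrite card_sum -!cardsT !cs cardsT card_ord; lia.
by move=> B; rewrite hP minimal_basesE card_imset // inr_im.
Qed.

Lemma minimal_rankP :
  isomorphic M (minimal_matroid r n) <->
  exists P, #|setT :\: P| = r /\ minimal_rank setT P (mrank M).
Proof.
rewrite isomorphic_minimalP; split=> -[P [cP hP]]; exists P; rewrite setTD in cP *.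
  split=> //; split=> [|A _]; first exact: subsetT.
  rewrite setTD cP.
  have AP (B : {set 'I_n}) : #|B| = #|B :&: P| + #|B :&: ~: P| by rewrite -setDE cardsID.
  have up (B : {set 'I_n}) : B \in bases M -> #|A :&: B| <= minn #|A :\: P|.+1 r.
    rewrite hP => /andP[/eqP cB cBP]; rewrite leq_min -[X in _ && (_ <= X)]cB.
    rewrite subset_leq_card ?subsetIr // andbT AP -addn1 addnC leq_add //.
      rewrite subset_leq_card //; apply/subsetP=> x; rewrite !inE.
      by move=> /andP[/andP[-> _] ->].
    apply: leq_trans cBP; rewrite subset_leq_card //; apply/subsetP=> x; rewrite !inE.
    by move=> /andP[/andP[_ ->] ->].
  (* The ranks are attained by the basis ~: P and by its exchanges of one element for an element of
     P. *)
  have bR : ~: P \in bases M by rewrite hP cP eqxx setIC setICr cards0.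
  have [A0|/set0Pn[p]] := eqVneq (A :&: P) set0.
    have sA : A \subset ~: P by rewrite -disjoints_subset -setI_eq0 A0.
    apply/eqP; rewrite eqn_leq; have [-> _ _] := mrank_function M.
    by have := mrank_ge A bR; rewrite (setIidPl sA).
  rewrite inE => /andP[pA pP].
  apply/eqP; rewrite eqn_leq; apply/andP; split.
    by have [B hB <-] := mrankP M A; apply: up.
  have [sRA|/subsetPn[i iR iA]] := boolP (~: P \subset A).
    by rewrite geq_min; apply/orP; right; have := mrank_ge A bR; rewrite (setIidPr sRA) cP.
  have pR : p \notin ~: P by rewrite inE pP.
  have hB : p |: (~: P :\ i) \in bases M.
    rewrite hP exchange_card // cP eqxx /=.
    have -> : (p |: (~: P :\ i)) :&: P = [set p].
      apply/setP=> x; rewrite !inE; case: eqP => [->|_] /=; first by rewrite pP.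
      by case: (x \in P); rewrite ?andbF.
    by rewrite cards1.
  rewrite geq_min; apply/orP; left; apply: leq_trans (mrank_ge A hB).
  have -> : A :&: (p |: (~: P :\ i)) = p |: (A :\: P).
    apply/setP=> x; rewrite !inE; case: eqP => [->|_] /=; first by rewrite pA.
    by have [->|] := eqVneq x i; rewrite ?(negbTE iA) ?andbF //= andbC.
  by rewrite cardsU1 !inE pP.
split=> // B; rewrite basis_mrank rM; case: eqP => //= cB.
have [_ h] := hP; rewrite (h _ (subsetT B)) setTD cP -cards_eq0.
have := cardsID P B; rewrite cB.
case: (#|B :&: P| =P 0) => [->|h0 c]; first by rewrite eqxx.
rewrite eqn_leq geq_minr leq_min leqnn andbT; move: h0 c; move: #|B :&: P| #|B :\: P| => a b; lia.
Qed.

End MinimalMatroid.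

(** * Integral points of dilated matroid polytopes *)

Section LatticePoints.

Lemma sum_split1 (T : finType) (x : T -> int) i :
  \sum_j x j = x i + \sum_(j in ~: [set i]) x j.
Proof. by rewrite (bigD1 i) //=; congr (_ + _); apply: eq_bigl => j; rewrite !inE. Qed.

Lemma sum_setT (T : finType) (x : T -> int) : \sum_(j in [set: T]) x j = \sum_j x j.
Proof. by apply: eq_bigl => j; rewrite inE. Qed.

(* Sandwiching an integral modular function between x - k rk and rk splits off
   a basis. *)
Lemma sum_of_bases (T : finType) (M : matroid T) k (x : T -> int) :
  (forall A : {set T}, \sum_(i in A) x i <= (k * mrank M A)%:Z) ->
  \sum_i x i = (k * rank M)%:Z ->
  exists b : 'I_k -> {set T}, (forall j, b j \in bases M) /\
    forall i, x i = \sum_j (i \in b j)%:R.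
Proof.
have rk := mrank_function M.
elim: k x => [|k IH] x le tot.
  (* For k = 0 each coordinate and the sum of the others are at most 0, and they add up to 0. *)
  exists (fun=> set0); split=> [[]//|i]; rewrite big_ord0.
  have := sum_split1 x i; rewrite tot; have := le (~: [set i]).
  by have := le [set i]; rewrite big_set1 !mul0n; clear; lia.
pose g (A : {set T}) : int := \sum_(i in A) x i - (k * mrank M A)%:Z.
have sumUI (A B : {set T}) : \sum_(i in A :|: B) x i + \sum_(i in A :&: B) x i =
    \sum_(i in A) x i + \sum_(i in B) x i.
  rewrite (big_setID A) /= setUK setDUl setDv set0U -addrA; congr (_ + _).
  by rewrite [RHS](big_setID A) /= setIC addrC.
have [||A B|A B|A|z hz] := @discrete_sandwich T (fun A => (mrank M A)%:Z) g.
- by rewrite (rank_set0 rk).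
- by rewrite /g (rank_set0 rk) big_set0 muln0.
- by case: rk => _ _ /(_ A B); lia.
- case: rk => _ _ /(_ A B) h; have := sumUI A B.
  have : (k * (mrank M (A :|: B) + mrank M (A :&: B)) <= k * (mrank M A + mrank M B))%N.
    by rewrite leq_mul2l h orbT.
  by rewrite !mulnDr /g; lia.
- by have := le A; rewrite mulSn /g; lia.
have zT : \sum_(i in [set: T]) z i = (rank M)%:Z.
  by have := hz setT; rewrite /g mrankT !sum_setT tot mulSn; lia.
(* The rank of a singleton gives z i <= 1; z i >= 0 because the other elements take at most the rank
   of M, which is the total. *)
have z01 i : z i = (i \in [set j | z j == 1])%:R.
  have z1 := hz [set i]; rewrite big_set1 in z1.
  have z2 := hz (~: [set i]).
  have := sum_split1 z i; rewrite -sum_setT zT.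
  have := rankS rk (subsetT (~: [set i])); rewrite mrankT.
  have := rank_le_card rk [set i]; rewrite cards1 inE.
  have := sum_split1 x i; move: z1 z2; rewrite tot /g big_set1 mulSn.
  case: eqP; lia.
pose B := [set j | z j == 1].
have sumz (A : {set T}) : \sum_(i in A) z i = #|A :&: B|%:Z.
  rewrite (eq_bigr (fun i => if i \in B then 1 else 0)) => [|i _]; last first.
    by rewrite z01 -/B; case: ifP.
  rewrite -big_mkcondr /= (eq_bigl (fun i => i \in A :&: B)) => [|i]; last by rewrite [RHS]inE.
  by rewrite sumr_const natz.
have hB : B \in bases M.
  have cB : #|B| = rank M.
    by have := sumz setT; rewrite zT setTI => -[].
  rewrite basis_mrank cB eqxx /=; have := hz B; rewrite sumz setIid cB.
  by have := rank_le_card rk B; rewrite cB; lia.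
have [A||b [hb xb]] := IH (fun i => x i - z i).
- by have /andP[h _] := hz A; rewrite sumrB lerBlDr addrC -lerBlDr.
- by rewrite sumrB -[\sum_i z i]sum_setT zT tot mulSn; lia.
exists (fun j => if unlift ord_max j is Some j' then b j' else B); split=> [j|i].
  by case: unliftP.
rewrite big_ord_recr /= unlift_none -z01 -[LHS](subrK (z i)) xb; congr (_ + _).
apply: eq_bigr => j _; have -> : widen_ord (leqnSn k) j = lift ord_max j.
  by apply: val_inj; rewrite /= /bump leqNgt ltn_ord.
by rewrite liftK.
Qed.
(** The rank inequalities pass from bases to convex combinations. Conversely, [sum_of_bases] makes
    an integral solution a sum of k bases, that is, k times the average of their indicators. *)
Lemma lattice_pointsP (R : realType) n (M : matroid 'I_n) k (z : 'rV[int]_n) :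
  lattice_points (@matroid_polytope R n M) k z <->
  (forall A : {set 'I_n}, \sum_(i in A) z ord0 i <= (k * mrank M A)%:Z) /\
  \sum_i z ord0 i = (k * rank M)%:Z.
Proof.
split=> [[x [m [w [v [w0 w1 vB xE]]]] zx]|[le tot]].
  have /fin_all_exists[B hB] : forall j : 'I_m, exists B, B \in bases M /\ v j = @indicator_vec R n B.
    by move=> j; have [B hB <-] := vB j; exists B.
  have sumz (A : {set 'I_n}) :
      (\sum_(i in A) z ord0 i)%:~R = k%:R * \sum_j w j * #|A :&: B j|%:R :> R.
    rewrite rmorph_sum /=.
    have zi i : (z ord0 i)%:~R = k%:R * \sum_j w j * (i \in B j)%:R :> R.
      have := congr1 (fun u : 'rV_n => u ord0 i) zx; rewrite !mxE => ->; congr (_ * _).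
      rewrite xE summxE; apply: eq_bigr => j _; rewrite mxE; congr (_ * _).
      by rewrite (hB j).2 mxE.
    rewrite (eq_bigr _ (fun i _ => zi i)) -mulr_sumr exchange_big /=; congr (_ * _).
    apply: eq_bigr => j _; rewrite -mulr_sumr; congr (_ * _).
    rewrite -sum1_card natr_sum big_mkcond [RHS]big_mkcond; apply: eq_bigr => i _.
    by rewrite inE; case: (i \in A); case: (i \in B j).
  split=> [A|].
    rewrite -(ler_int R) sumz -[X in _ <= X]/((k * mrank M A)%:R) natrM ler_wpM2l ?ler0n //.
    rewrite -[leRHS]mul1r -[X in _ <= X * _]w1 mulr_suml; apply: ler_sum => j _.
    by apply: ler_wpM2l; rewrite ?w0 // ler_nat mrank_ge // (hB j).1.
  apply/eqP; rewrite -(eqr_int R) -sum_setT sumz -[X in _ == X]/((k * rank M)%:R) natrM.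
  apply/eqP; congr (_ * _); rewrite -[RHS]mul1r -[X in _ = X * _]w1 mulr_suml; apply: eq_bigr => j _.
  by rewrite setTI (card_basis (hB j).1).
have [b [hb zb]] := sum_of_bases le tot.
have in_hull (B : {set 'I_n}) : B \in bases M -> @matroid_polytope R n M (@indicator_vec R n B).
  move=> hB; exists 1%N, (fun=> 1), (fun=> @indicator_vec R n B); split=> //.
  - by rewrite big_ord1.
  - by move=> _; exists B.
  - by rewrite big_ord1 scale1r.
(* For k = 0 there is no average to take, but z = 0 and any vertex will do. *)
case: k b hb zb le tot => [|k] b hb zb _ _.
  have /set0Pn[B hB] := bases_neq0 M.
  exists (@indicator_vec R n B); first exact: in_hull.
  by apply/rowP => i; rewrite !mxE (_ : z 0 i = 0) ?mul0r // zb big_ord0.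
have k0 : k.+1%:R != 0 :> R by rewrite pnatr_eq0.
exists (\sum_(j < k.+1) k.+1%:R^-1 *: @indicator_vec R n (b j)).
  exists k.+1, (fun=> k.+1%:R^-1), (fun j => @indicator_vec R n (b j)); split=> //.
  - by move=> _; rewrite invr_ge0 ler0n.
  - by rewrite sumr_const card_ord -[_ *+ _]mulr_natr mulVf.
  - by move=> j; exists (b j) => //; exact: hb.
apply/rowP => i; rewrite !mxE summxE zb rmorph_sum mulr_sumr; apply: eq_bigr => j _.
by rewrite !mxE mulVKf // rmorph_nat.
Qed.

End LatticePoints.

Section EhrhartLinearCoefficient.

Lemma lattice_points_card (R : realType) n (M : matroid 'I_n) k :
  (lattice_points (@matroid_polytope R n M) k
     #= `I_(base_count (dilate k (mrank M))))%card.
Proof.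
set f := dilate k (mrank M); rewrite /base_count; set D := [set x | _]%SET.
have rk := mrank_function M.
pose h (x : {ffun 'I_n -> 'I_(f setT).+1}) : 'rV[int]_n := \row_i (x i)%:Z.
have sumh x (A : {set 'I_n}) : \sum_(i in A) h x ord0 i = (mass x A)%:Z.
  rewrite /mass (big_morph Posz PoszD (erefl _)); apply: eq_bigr => i _.
  by rewrite mxE.
have hinj : injective h.
  move=> x y /rowP E; apply/ffunP => i; apply: val_inj.
  by have := E i; rewrite !mxE => -[].
have fT : f setT = (k * rank M)%N by rewrite /f /dilate mrankT.
have DP x : x \in D <-> (forall A : {set 'I_n}, \sum_(i in A) h x ord0 i <= (k * mrank M A)%:Z) /\
    \sum_i h x ord0 i = (k * rank M)%:Z.
  rewrite inE -sum_setT sumh; split=> [/andP[/eqP mx /forallP lx]|[lx mx]].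
    by split=> [A|]; [rewrite sumh; have := lx A | rewrite mx fT].
  apply/andP; split; first by move: mx; rewrite -fT => -[->].
  by apply/forallP => A; have := lx A; rewrite sumh.
pose x0 : {ffun 'I_n -> 'I_(f setT).+1} := [ffun=> ord0].
pose t j := h (nth x0 (enum D) j).
have -> : lattice_points (@matroid_polytope R n M) k = (t @` `I_(#|D|))%classic.
  apply/seteqP; split=> z; last first.
    case=> j /= jD <-; apply/lattice_pointsP/DP.
    by rewrite -mem_enum mem_nth // -cardE.
  move=> /lattice_pointsP [le tot].
  (* The total is k times the rank and the other coordinates take at most that, so z has nonnegative
     entries; with [zf] it comes from a point counted by [base_count]. *)
  have z0 i : 0 <= z ord0 i.
    have := sum_split1 (z ord0) i; rewrite tot => E.
    have := le (~: [set i])%SET; rewrite -(lerD2l (z ord0 i)) -E => h2.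
    have := rankS rk (subsetT (~: [set i])%SET); rewrite mrankT => h1.
    have : (k * mrank M (~: [set i])%SET <= k * rank M)%N by rewrite leq_mul2l h1 orbT.
    by move: h2; move: (k * mrank M _)%N (k * rank M)%N; clear; lia.
  have zf i : (`|z ord0 i| < (f setT).+1)%N.
    have := le [set i]%SET; rewrite big_set1 /f /dilate.
    have := rankS rk (subsetT [set i]%SET) => h1.
    have : (k * mrank M [set i]%SET <= k * mrank M setT)%N by rewrite leq_mul2l h1 orbT.
    by have := z0 i; move: (k * mrank M [set i]%SET)%N (k * mrank M setT)%N; clear; lia.
  pose x : {ffun 'I_n -> 'I_(f setT).+1} := [ffun i => inord `|z ord0 i|%N].
  have hx : h x = z.
    by apply/rowP => i; rewrite mxE ffunE inordK // gez0_abs ?(ord1 0).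
  have xD : x \in D by apply/DP; rewrite hx.
  exists (index x (enum D)); first by rewrite /= cardE index_mem mem_enum.
  by rewrite /t nth_index ?mem_enum.
apply: inj_card_eq => i j; move=> /set_mem /= iD /set_mem /= jD /hinj/eqP.
by rewrite nth_uniq ?enum_uniq -?cardE // => /eqP.
Qed.

Lemma mrank_grounded n (M : matroid 'I_n) : grounded_monotone (mrank M).
Proof.
have rk := mrank_function M; split; first exact: rank_set0.
exact: rankS rk.
Qed.

Lemma ehrhart_deriv (R : realType) n (M : matroid 'I_n) p : (0 < n)%N ->
  is_ehrhart_poly R M p ->
  p^`().[0] = lincoef setT (fun A => (mrank M A)%:R).
Proof.
move=> n0 hp; apply: base_count_deriv => [|||t].
- by rewrite -card_gt0 cardsT card_ord.
- exact: mrank_grounded.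
- by case: (mrank_function M).
have [m hm ->] := hp t; congr _%:R; apply/card_eq_II.
by apply: card_eq_trans hm; rewrite card_eq_sym; apply: lattice_points_card.
Qed.

End EhrhartLinearCoefficient.

Theorem proposition4 (R : realType) (n r l : nat) (M : matroid 'I_n)
    (ehr : {poly rat}) (n_ge2 : (2 <= n)%N) (M_conn : connected M)
    (rM : rank M = r) (lE : l = (n - r)%N) (ehrM : is_ehrhart_poly R M ehr) :
  let lower_bound : rat :=
    harmonic_number (r - 1) + harmonic_number (l - 1) +
    ((n - 1) * 'C(n - 2, r - 1))%:R^-1 in
  lower_bound <= ehr^`().[0] /\
  (lower_bound = ehr^`().[0] <-> isomorphic M (minimal_matroid r n)).
Proof.
move=> lb; have rk := mrank_function M.
have cM := connected_rconnected M_conn.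
have cT : #|[set: 'I_n]%SET| = n by rewrite cardsT card_ord.
have T2 : (1 < #|[set: 'I_n]%SET|)%N by rewrite cT.
have r0 := rconnected_rank_gt0 rk cM T2.
have rn := rconnected_rank_lt rk cM T2.
rewrite cT mrankT rM in rn; rewrite mrankT rM in r0.
have lbE : lb = minimal_coef r n.
  rewrite /lb /minimal_coef lE !subn1 beta_bin; congr (_ + (_ * 'C(_, _))%:R^-1); lia.
rewrite (ehrhart_deriv (ltnW n_ge2) ehrM) lbE (minimal_rankP rM r0 rn).
have [] := lincoef_ge_minimal rk cM T2; rewrite mrankT rM cT => le1 eq1.
split=> //; split=> [/esym/eq1 //|[P [cP hP]]].
rewrite (lincoef_minimal rk _ _ hP) ?cP ?cT //; rewrite -card_gt0 ?cP //.
by have := cardsID P setT; rewrite setTI cP cT; lia.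
Qed.
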